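(* Assume problem $(\mathcal P)$ (defined in the context) is feasible. Let $w\in\mathbf{R}^N$ be a random variable with uniform distribution on the unit sphere, and consider the feasible convex problem $$(\mathcal R)\qquad \text{minimize } w^Tx\quad\text{subject to } Ax\le b,\; Gx=h,\; \hat f(x)\le\hat p .$$ Then with probability one, $(\mathcal R)$ has a unique solution $x^\star$, and it satisfies $$f(x^\star)\le \hat p+\sum_{i=1}^{\min(\tilde m,n)}\rho(f_i),$$ i.e., $x^\star$ is $\epsilon$-suboptimal for $(\mathcal P)$, meaning $f(x^\star)\le p^\star+\epsilon$, with $\epsilon=\sum_{i=1}^{\min(\tilde m,n)}\rho(f_i)$.
   Context: Setting. Let $N=\sum_{i=1}^n n_i$ and write $x=(x_1,\dots,x_n)\in\mathbf{R}^N$ with blocks $x_i\in\mathbf{R}^{n_i}$. For each $i$, $S_i\subset\mathbf{R}^{n_i}$ is a compact set and $f_i:S_i\to\mathbf{R}$ is lower semi-continuous (no convexity of $f_i$ or $S_i$ is assumed). Let $A\in\mathbf{R}^{m_1\times N}$, $b\in\mathbf{R}^{m_1}$, $G\in\mathbf{R}^{m_2\times N}$, $h\in\mathbf{R}^{m_2}$. The problem $(\mathcal P)$ is: minimize $f(x)=\sum_{i=1}^n f_i(x_i)$ subject to $Ax\le b$, $Gx=h$ (with $x_i\in S_i$ for all $i$); its optimal value is $p^\star$. A point $x$ is feasible for $(\mathcal P)$ if $Ax\le b$, $Gx=h$ and $x_i\in S_i$ for all $i$; $(\mathcal P)$ is feasible if it has a feasible point. It is assumed that each of the linear equality and inequality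 constraints involves at least two blocks of variables. Conventions. Functions are taken to be $+\infty$ outside their domains, so $f(x)=+\infty$ if some $x_i\notin S_i$, $\hat f(x)=+\infty$ if some $x_i\notin\mathrm{conv}(S_i)$, and $\infty-\infty$ is interpreted as $0$. Inequalities are in the extended reals. Convex envelope. $\hat f_i:\mathrm{conv}(S_i)\to\mathbf{R}$ denotes the convex envelope of $f_i$, the largest closed convex function majorized by $f_i$ (i.e. $\hat f_i(x)\le f_i(x)$ for all $x$). Convexified problem $(\hat{\mathcal P})$: minimize $\hat f(x)=\sum_{i=1}^n\hat f_i(x_i)$ subject to $Ax\le b$, $Gx=h$ (with $x_i\in\mathrm{conv}(S_i)$ for all $i$); its optimal value is $\hat p$. Nonconvexity. $\rho(f_i)=\sup_x\,(f_i(x)-\hat f_i(x))\in[0,\infty]$, with the supremum taken with $f_i$ and $\hat f_i$ equal to $+\infty$ outside their respective domains $S_i$ and $\mathrm{conv}(S_i)$ and with $\infty-\infty$ interpreted as $0$ (so it may be $+\infty$). The functions are indexed so that $\rho(f_1)\ge\cdots\ge\rho(f_n)$. Number of active constraints. For $x\in\mathbf{R}^N$ let $J(x)=\{j:(Ax-b)_j=0\}$ be the active set of inequality constraints, $\tilde m_1=\max_{x}|J(x)|$ the maximal number of inequality constraints that can be simultaneously active (maximum over $x\in\mathbf{R}^N$), and $\tilde m=\tilde m_1+m_2$. *)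

(* Defs.v *)
From HB Require Import structures.
From mathcomp Require Import all_boot all_order all_algebra.
From mathcomp Require Import all_classical all_reals all_analysis.

Set Implicit Arguments.
Unset Strict Implicit.
Unset Printing Implicit Defensive.

Import Order.TTheory GRing.Theory Num.Theory.
Import numFieldNormedType.Exports.

Local Open Scope classical_set_scope.
Local Open Scope ring_scope.

Section ConvexEnvelope.
Context {R : realType} {E : normedModType R}.
Implicit Types (D S : set E) (f g : E -> \bar R).
Local Open Scope ereal_scope.

Definition conv_hull S : set E := smallest (@convex_set R E) S.

Definition pinfty_outside D g : E -> \bar R :=
  fun x => if x \in D then g x else +oo.

Definition epigraph g : set (E * R^o)%type := [set p | g p.1 <= p.2%:E].

Definition closed_convex_function g :=
  [/\ forall x, g x != -oo, convex_set (epigraph g) & closed (epigraph g)].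

Definition closed_convex_minorant f : set (E -> \bar R) :=
  [set g | closed_convex_function g /\ forall x, g x <= f x].

Definition convex_envelope f : E -> \bar R :=
  fun x => ereal_sup [set g x | g in closed_convex_minorant f].

Lemma epigraph_convex_envelope f :
  epigraph (convex_envelope f) =
  \bigcap_(g in closed_convex_minorant f) epigraph g.
Proof.
apply/seteqP; split => [p /= fp g fg|p fp /=].
  by apply: le_trans fp; apply: ereal_sup_ubound; exists g.
by apply: ge_ereal_sup => _ [g fg <-]; exact: fp.
Qed.

(* The pointwise supremum is itself a closed convex minorant, hence the
   largest one. *)
Lemma convex_envelope_largest f : closed_convex_minorant f !=set0 ->
  closed_convex_minorant f (convex_envelope f) /\
  forall g, closed_convex_minorant f g -> forall x, g x <= convex_envelope f x.
Proof.
move=> [g0 fg0]; have ub g : closed_convex_minorant f g ->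
    forall x, g x <= convex_envelope f x.
  by move=> fg x; apply: ereal_sup_ubound; exists g.
split => //; split; last first.
  by move=> x; apply: ge_ereal_sup => _ [g [_ gf] <-].
split.
- move=> x; have [[/(_ x) g0x _ _] _] := fg0.
  by rewrite -ltNye (lt_le_trans _ (ub _ fg0 x))// ltNye.
- rewrite epigraph_convex_envelope => p q t; rewrite !inE => pE qE g fg.
  have [[_ cg _] _] := fg.
  by apply/set_mem/cg; apply/mem_set; [exact: pE|exact: qE].
- rewrite epigraph_convex_envelope; apply: closed_bigI => g fg.
  by have [[]] := fg.
Qed.

(* +oo - +oo = 0 here, whereas it is -oo in \bar R. *)
Definition esub0 (a b : \bar R) : \bar R :=
  if (a == +oo) && (b == +oo) then 0 else a - b.

Section Component.
Variables (S : set E) (f : E -> R).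

Definition ext_fun : E -> \bar R := pinfty_outside S (EFin \o f).

Definition ext_envelope : E -> \bar R :=
  pinfty_outside (conv_hull S) (convex_envelope ext_fun).

Definition nonconvexity : \bar R :=
  ereal_sup (range (fun x => esub0 (ext_fun x) (ext_envelope x))).

End Component.
End ConvexEnvelope.

Definition dotp {R : realType} {N : nat} (u v : 'cV[R]_N) : R :=
  (u^T *m v) 0 0.

Section UniformSphere.
Variables (R : realType) (N : nat).

Definition borel_cV := g_sigma_algebraType (@open 'cV[R]_N).

(* The Euclidean sphere: the library norm on matrices is the sup norm. *)
Definition unit_sphere : set borel_cV := [set x | dotp x x = 1].

(* The uniform distribution on the sphere is the unique Borel probability
   measure carried by it that is invariant under the orthogonal group. *)
Definition uniform_on_sphere (mu : probability borel_cV R) : Prop :=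
  mu unit_sphere = 1%E /\
  forall Q : 'M[R]_N, Q^T *m Q = 1%:M ->
  forall B : set borel_cV, measurable B ->
    mu ((fun x : borel_cV => Q *m x : borel_cV) @^-1` B) = mu B.

End UniformSphere.

Section SeparableProblem.
Context {R : realType} {n : nat} {d : 'I_n -> nat}.
Local Notation N := (\sum_i d i)%N.

Definition separable_sum (phi : forall i, 'cV[R]_(d i) -> \bar R)
    (x : 'cV[R]_N) : \bar R :=
  (\sum_i phi i (submxcol x i))%E.

Definition involves {m : nat} (M : 'M[R]_(m, N)) (j : 'I_m) (i : 'I_n) : Prop :=
  row j (submxrow M i) != 0.

Definition involves_two_blocks {m : nat} (M : 'M[R]_(m, N)) : Prop :=
  forall j, exists i k, [/\ i != k, involves M j i & involves M j k].

Section Constraints.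
Context {m1 m2 : nat}.
Variables (A : 'M[R]_(m1, N)) (b : 'cV[R]_m1).
Variables (G : 'M[R]_(m2, N)) (h : 'cV[R]_m2).

Definition lin_feasible : set 'cV[R]_N :=
  [set x | (forall j, (A *m x) j 0 <= b j 0) /\ G *m x = h].

Definition optimal_value (F : 'cV[R]_N -> \bar R) : \bar R :=
  ereal_inf [set F x | x in lin_feasible].

Definition active (x : 'cV[R]_N) : {set 'I_m1} :=
  [set j | (A *m x - b) j 0 == 0].

Definition max_active : nat :=
  \max_(J : {set 'I_m1} | `[< exists x, active x = J >]) #|J|.

End Constraints.
End SeparableProblem.

Definition is_minimizer {R : realType} {T : Type} (C : set T) (F : T -> R)
    (x : T) : Prop :=
  C x /\ forall y, C y -> F x <= F y.

(* Main.v *)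
Require Import Defs.
From HB Require Import structures.
From mathcomp Require Import all_boot all_order all_algebra.
From mathcomp Require Import all_classical all_reals all_analysis.
From mathcomp Require Import ring lra.

Set Implicit Arguments.
Unset Strict Implicit.
Unset Printing Implicit Defensive.

Import Order.TTheory GRing.Theory Num.Theory.
Import numFieldNormedType.Exports.

Local Open Scope classical_set_scope.
Local Open Scope ring_scope.

(* The feasible set of (R) is the optimal set of the convexified problem; it is
   compact because, by Caratheodory, the epigraph of the envelope of f_i is the
   set of convex combinations of at most d_i + 2 points of the epigraph of f_i.

   A linear form w has two minimizers x, y on a compact set only if their
   values along some tangent direction J w are separated by rationals p < q.
   Moving w by small rotations generated by J gives arbitrarily many pairwise
   disjoint rotated copies of the set of such unit vectors w, all with the same
   measure, so that set is null.

   If the envelope is smaller than f_i at the block x_i of the unique minimizer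
   x, the envelope is bounded by an affine function along some segment centred
   at x_i.  With more than m~ such blocks, a nontrivial combination of these
   segments keeps the equality and active inequality constraints; by optimality
   it has slope 0, and w would be minimal along it.  So at most m~ blocks have
   f_i > envelope, each contributing at most rho(f_i). *)

(** * Caratheodory's theorem for cones *)

(** The vectors indexed by [T] are the rows of a matrix of rank at most [p < #|T|], so its row
    kernel is nonzero; a kernel vector is extended by zero outside [T]. *)
Lemma linear_dependence (F : fieldType) (I : finType) (T : {set I}) (p : nat)
    (u : I -> 'cV[F]_p) : (p < #|T|)%N ->
  exists a : I -> F, [/\ exists i, a i != 0, forall i, i \notin T -> a i = 0 &
    \sum_i a i *: u i = 0].
Proof.
move=> pT; pose M : 'M[F]_(#|T|, p) := \matrix_(k, j) u (enum_val k) j 0.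
have : kermx M != 0.
  rewrite kermx_eq0 -row_leq_rank -ltnNge.
  exact: leq_ltn_trans (rank_leq_col M) pT.
case/rowV0Pn => z /sub_kermxP zM /rV0Pn[k zk].
have [i0 i0T] : exists i, i \in T by exists (enum_val k); exact: enum_valP.
exists (fun i => if i \in T then z 0 (enum_rank_in i0T i) else 0); split.
- by exists (enum_val k); rewrite enum_valP enum_valK_in.
- by move=> i /negbTE ->.
- rewrite (bigID (mem T)) /= [X in _ + X]big1 ?addr0; last first.
    by move=> i /negbTE ->; rewrite scale0r.
  rewrite big_enum_val /=; apply/colP => j.
  have := congr1 (fun v : 'rV_p => v 0 j) zM; rewrite !mxE summxE => zM0.
  rewrite -[RHS]zM0; apply: eq_bigr => i _.
  by rewrite !mxE enum_valP enum_valK_in.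
Qed.

(** Induction on the size of the support: while it exceeds [p], a linear dependence supported there
    is subtracted with the largest multiple that keeps all coefficients nonnegative, which makes one
    of them vanish. *)
Lemma conic_caratheodory (R : realFieldType) (I : finType) (p : nat)
    (u : I -> 'cV[R]_p) (l : I -> R) : (forall i, 0 <= l i) ->
  exists l' : I -> R, [/\ forall i, 0 <= l' i,
    \sum_i l' i *: u i = \sum_i l i *: u i &
    (#|[set i | l' i != 0%R]%SET| <= p)%N].
Proof.
have [k] := ubnP #|[set i | l i != 0%R]%SET|; elim: k l => // k IH l.
rewrite ltnS => lk l0.
have [lep|ltp] := leqP #|[set i | l i != 0%R]%SET| p; first by exists l.
have [a [[i1 ai1] aT au]] := linear_dependence u ltp.
wlog [i2 ai2] : a ai1 aT au / exists i, 0 < a i => [wl|].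
  have [ai1'|ai1'] := ltP 0 (a i1); first by apply: (wl a) => //; exists i1.
  apply: (wl (fun i => - a i)).
  - by rewrite oppr_eq0.
  - by move=> i /aT ->; rewrite oppr0.
  - under eq_bigr do rewrite scaleNr.
    by rewrite sumrN au oppr0.
  - by exists i1; rewrite oppr_gt0 lt_neqAle ai1.
have [i3 /= ai3 min3] := @Order.TotalTheory.arg_minP _ _ _ i2
  (fun i => 0 < a i) (fun i => l i / a i) ai2.
(* [i3] minimizes [l i / a i] over the positive [a i], so [t] is the first value at which some
   [l i - t * a i] reaches 0. *)
pose t := l i3 / a i3.
have t0 : 0 <= t by rewrite divr_ge0 // ltW.
have [] := IH (fun i => l i - t * a i).
- apply: leq_trans lk; apply: proper_card; apply/properP; split.
    apply/fintype.subsetP => i; rewrite !inE; apply: contra => /eqP li.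
    by rewrite li sub0r aT ?mulr0 ?oppr0 // inE li eqxx.
  exists i3; rewrite !inE.
    by apply: contraTneq ai3 => l3; rewrite aT ?ltxx // inE l3 eqxx.
  by rewrite negbK /t divfK ?subrr // gt_eqF.
- move=> i; rewrite subr_ge0.
  have [ai|ai] := ltP 0 (a i); first by rewrite -ler_pdivlMr // min3.
  by rewrite (le_trans _ (l0 i)) // mulr_ge0_le0.
- move=> l' [l'0 /= l'u l'p]; exists l'; split => //.
  rewrite l'u; under eq_bigr do rewrite scalerBl -scalerA.
  by rewrite sumrB -scaler_sumr au scaler0 subr0.
Qed.

(** * Limits of sums and products *)

Lemma cvg_near_neq (R : realFieldType) T (F : set_system T) {FF : Filter F}
    (f g : T -> R) (a b : R) :
  f @ F --> a -> g @ F --> b -> a <> b ->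
  \forall t \near F, f t <> g t.
Proof.
move=> fa gb ab.
have fgab : (f \- g) @ F --> a - b by exact: cvgB.
have ab0 : a - b != 0 by rewrite subr_eq0; exact/eqP.
by apply: filterS (cvgr_neq0 _ fgab ab0) => t /= /eqP + e; rewrite e subrr.
Qed.

Lemma cvg_sumr (R : realFieldType) T (F : set_system T) {FF : Filter F}
    (I : Type) (r : seq I) (f : I -> T -> R) (a : I -> R) :
  (forall i, f i @ F --> a i) ->
  (fun t => \sum_(i <- r) f i t) @ F --> \sum_(i <- r) a i.
Proof. by move=> fa; apply: cvg_big => //; exact: add_continuous. Qed.

(** Lower semicontinuity of a product, in filter form: [G] need not converge, only its strict lower
    bounds persist, and nonnegativity lets them be multiplied. *)
Lemma near_lt_mul (R : realFieldType) T (F : set_system T) {FF : Filter F}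
    (L G : T -> R) (l g : R) :
  0 <= g -> L @ F --> l -> (\forall t \near F, 0 <= L t) ->
  (\forall t \near F, 0 <= G t) ->
  (forall a, a < g -> \forall t \near F, a < G t) ->
  forall a, a < l * g -> \forall t \near F, a < L t * G t.
Proof.
move=> g0 Ll L0 G0 Gg a alg.
have [a0|a0] := ltP a 0.
  by near=> t; apply: lt_le_trans a0 _; apply: mulr_ge0; near: t.
have {}g0 : 0 < g.
  rewrite lt_neqAle g0 andbT; apply: contraTneq alg => <-.
  by rewrite mulr0 -leNgt.
(* [g'] lies strictly between [a / l] and [g], so eventually [G t > g'] and [L t > a / g']. *)
pose g' := (a / l + g) / 2.
have l0 : 0 < l by rewrite -(pmulr_lgt0 _ g0) (le_lt_trans a0).
have alg' : a / l < g by rewrite ltr_pdivrMr // mulrC.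
have g'g : g' < g by rewrite /g'; lra.
have ag' : a / l < g' by rewrite /g'; lra.
have g'0 : 0 < g' by apply: le_lt_trans ag'; rewrite divr_ge0 // ltW.
have al' : a / g' < l by rewrite ltr_pdivrMr // mulrC -ltr_pdivrMr.
near=> t.
apply: lt_trans (_ : L t * g' < _).
  rewrite -ltr_pdivrMr //; near: t; exact: (cvgr_gt _ Ll).
rewrite ltr_pM2l; first by near: t; exact: Gg.
by near: t; exact: (cvgr_gt _ Ll).
Unshelve. all: end_near. Qed.

Lemma near_lt_sum (R : realFieldType) T (F : set_system T) {FF : Filter F}
    (I : finType) (G : I -> T -> R) (g : I -> R) :
  (forall i a, a < g i -> \forall t \near F, a < G i t) ->
  forall a, a < \sum_i g i -> \forall t \near F, a < \sum_i G i t.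
Proof.
move=> Gg a aS.
(* The gap is cut into one share more than there are terms: the total loss stays strictly below it,
   even for an empty [I]. *)
pose e := (\sum_i g i - a) / #|I|.+1%:R.
have e0 : 0 < e by rewrite divr_gt0 ?subr_gt0.
have : \forall t \near F, forall i, g i - e < G i t.
  by apply: filter_forall => i; apply: Gg; rewrite ltrBlDr ltrDl.
apply: filterS => t Gt.
apply: lt_le_trans (_ : \sum_i (g i - e) <= _); last first.
  by apply: ler_sum => i _; exact/ltW/Gt.
rewrite sumrB sumr_const ltrBrDl -ltrBrDr.
rewrite -mulr_natr /e mulrAC ltr_pdivrMr //.
by rewrite ltr_pM2l ?subr_gt0 // ltr_nat.
Qed.

(** * Finite convex combinations *)

Lemma convex_setP (R : numDomainType) (E : lmodType R)
    (A : set (convex_lmodType E)) :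
  convex_set A <-> forall (x y : E) (t : R), 0 <= t -> t <= 1 -> A x -> A y ->
    A (t *: x + (1 - t) *: y).
Proof.
split=> [cA x y t t0 t1 Ax Ay|cA x y t].
  by have := cA x y (Itv01 t0 t1); rewrite !inE; exact.
by rewrite !inE => Ax Ay; apply: cA.
Qed.

Lemma convex_set_sum (R : realFieldType) (E : lmodType R)
    (A : set (convex_lmodType E)) (I : finType) (l : I -> R) (x : I -> E) :
  convex_set A -> (forall i, 0 <= l i) -> \sum_i l i = 1 ->
  (forall i, A (x i)) -> A (\sum_i l i *: x i).
Proof.
move=> cA l0 l1 Ax.
(* Partial sums are renormalized to total weight 1, so that induction over the list of indices
   applies. *)
suff H (s : seq I) : 0 < \sum_(i <- s) l i ->
    A ((\sum_(i <- s) l i)^-1 *: \sum_(i <- s) l i *: x i).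
  by have := H (index_enum I); rewrite l1 invr1 scale1r; apply.
elim: s => [|i s IH]; first by rewrite big_nil ltxx.
rewrite !big_cons => lis.
set L := \sum_(j <- s) l j in IH lis *.
have L0 : 0 <= L by exact: sumr_ge0.
have [L00|Lneq0] := eqVneq L 0.
  have -> : \sum_(j <- s) l j *: x j = 0.
    rewrite big_seq big1 // => j js; move/eqP: L00.
    rewrite /L psumr_eq0 // => /allP/(_ _ js) /eqP ->.
    by rewrite scale0r.
  rewrite L00 addr0 in lis *.
  by rewrite addr0 scalerA mulVf ?scale1r // gt_eqF.
have {}L0 : 0 < L by rewrite lt_neqAle eq_sym Lneq0.
have := IH L0 => {}IH; set z := \sum_(j <- s) _ in IH *.
have -> : (l i + L)^-1 *: (l i *: x i + z) =
    (l i / (l i + L)) *: x i + (1 - l i / (l i + L)) *: (L^-1 *: z).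
  rewrite scalerDr !scalerA; congr (_ + _); first by rewrite mulrC.
  congr (_ *: _).
  by field; rewrite ?gt_eqF.
apply: (iffLR (convex_setP _) cA) => //.
  by rewrite divr_ge0 // ltW.
by rewrite ler_pdivrMr // mul1r lerDl ltW.
Qed.

Lemma coord_le_norm (R : realType) m n (M : 'M[R]_(m, n)) i j :
  `|M i j| <= `|M|.
Proof.
rewrite [leRHS]/Num.norm /= mx_normrE; apply/bigmax_geP; right.
by exists (i, j).
Qed.

(** * The epigraph of the envelope of one component *)

Lemma sum_ord_pad (V : nmodType) (I : finType) (J : {set I}) (i0 : I) (m : nat)
    (F : I -> V) : (#|J| <= m)%N ->
  \sum_(i in J) F i =
  \sum_(k < m) (if (k < #|J|)%N then F (nth i0 (enum J) k) else 0).
Proof.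
move=> Jm; rewrite -big_enum /= (big_nth i0) big_mkord -cardE.
by rewrite (big_ord_widen _ (fun k => F (nth i0 (enum J) k)) Jm) big_mkcond.
Qed.

(** The entries lie in an arbitrary topological space because the lemma also serves rows whose
    entries are column vectors. *)
Lemma cvg_mx_coord (T : topologicalType) m n (M : 'M[T]_(m, n)) i j :
  (fun N : 'M[T]_(m, n) => N i j) @ M --> M i j.
Proof.
move=> A MA; exists (fun i' j' => if (i' == i) && (j' == j) then A else setT).
  move=> i' j'; case: ifPn => [/andP[/eqP-> /eqP->]//|_].
  exact: filterT.
by move=> N /= /(_ i j); rewrite !eqxx.
Qed.

Section ComponentEnvelope.
Context {R : realType} {d : nat}.
Variables (S : set 'cV[R]_d) (f : 'cV[R]_d -> R).

(* d + 2 points suffice: Caratheodory is applied to the vectors (1, f x, x). *)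
Definition comb_epi : set ('cV[R]_d * R^o)%type :=
  [set p | exists (l : 'rV[R]_d.+2) (X : 'rV['cV[R]_d]_d.+2),
    [/\ forall j, 0 <= l 0 j, \sum_j l 0 j = 1, forall j, S (X 0 j),
      \sum_j l 0 j *: X 0 j = p.1 & \sum_j l 0 j * f (X 0 j) <= p.2]].

(** The lift [(1, f x, x)] turns a convex combination into a conic one in dimension [d + 2]: its
    first coordinate keeps the total weight, the second the value, the others the barycentre. *)
Lemma comb_epi_of_comb (I : finType) (l : I -> R) (x : I -> 'cV[R]_d) (a : R) :
  (forall i, 0 <= l i) -> \sum_i l i = 1 -> (forall i, S (x i)) ->
  \sum_i l i * f (x i) <= a -> comb_epi (\sum_i l i *: x i, a).
Proof.
move=> l0 l1 Sx fa.
(* [I] is inhabited because the weights sum to 1; [i0] is the default of [nth], so that padding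
   positions of weight 0 also hold a point of [S]. *)
have [i0 _] : exists i0 : I, true.
  apply/existsP; apply: contraT; rewrite negb_exists => /forallP noI.
  by have := oner_neq0 R; rewrite -l1 big1 ?eqxx // => i; have := noI i.
pose u i : 'cV[R]_(1 + (1 + d)) := col_mx 1%:M (col_mx (f (x i))%:M (x i)).
have [l' [l'0 l'u l'J]] := conic_caratheodory u l0.
have l'1 : \sum_i l' i = 1.
  have := congr1 (fun v : 'cV[R]_(1 + (1 + d)) => (usubmx v) 0 0) l'u.
  rewrite !linear_sum /= !summxE -l1 => e.
  transitivity (\sum_i (usubmx (l' i *: u i)) 0 0); last rewrite e;
    by apply: eq_bigr => i _; rewrite linearZ /= col_mxKu !mxE mulr1.
have l'f : \sum_i l' i * f (x i) = \sum_i l i * f (x i).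
  have := congr1 (fun v : 'cV[R]_(1 + (1 + d)) => (usubmx (dsubmx v)) 0 0) l'u.
  rewrite !linear_sum /= !summxE => e.
  transitivity (\sum_i (usubmx (dsubmx (l' i *: u i))) 0 0); last rewrite e;
    by apply: eq_bigr => i _; rewrite !linearZ /= col_mxKd col_mxKu !mxE mulr1n.
have l'x : \sum_i l' i *: x i = \sum_i l i *: x i.
  have := congr1 (fun v : 'cV[R]_(1 + (1 + d)) => dsubmx (dsubmx v)) l'u.
  rewrite !linear_sum /= => e.
  transitivity (\sum_i (dsubmx (dsubmx (l' i *: u i)))); last rewrite e;
    by apply: eq_bigr => i _; rewrite !linearZ /= !col_mxKd.
set J := [set i | l' i != 0]%SET in l'J.
have sumJ (V : nmodType) (F : I -> V) : (forall i, l' i = 0 -> F i = 0) ->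
    \sum_i F i = \sum_(i in J) F i.
  move=> F0; rewrite [RHS]big_mkcond /=; apply: eq_bigr => i _.
  by rewrite inE; case: eqP => //= /F0.
have pad (V : nmodType) (F : I -> V) : (forall i, l' i = 0 -> F i = 0) ->
    \sum_i F i = \sum_(k < d.+2)
      (if (k < #|J|)%N then F (nth i0 (enum J) k) else 0).
  by move=> F0; rewrite sumJ // (@sum_ord_pad _ _ _ i0 d.+2).
exists (\row_k if (k < #|J|)%N then l' (nth i0 (enum J) k) else 0).
exists (\row_k x (nth i0 (enum J) k)); split => /=.
- by move=> j; rewrite mxE; case: ifP.
- by rewrite -l'1 pad //; apply: eq_bigr => k _; rewrite mxE.
- by move=> j; rewrite mxE.
- rewrite -l'x pad => [|i ->]; last by rewrite scale0r.
  by apply: eq_bigr => k _; rewrite !mxE; case: ifP; rewrite ?scale0r.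
- rewrite (le_trans _ fa) // -l'f pad => [|i ->]; last by rewrite mul0r.
  rewrite le_eqVlt; apply/orP; left; apply/eqP.
  by apply: eq_bigr => k _; rewrite !mxE; case: ifP; rewrite ?mul0r.
Qed.

(** Two combinations merge into one indexed by a sum type; [comb_epi_of_comb] brings the number of
    points back to [d + 2]. *)
Lemma comb_epi_convex : convex_set comb_epi.
Proof.
apply/convex_setP => -[x a] [y b] t t0 t1.
move=> [l [X [l0 l1 SX /= <- la]]] [m [Y [m0 m1 SY /= <- mb]]].
pose w (s : 'I_d.+2 + 'I_d.+2) :=
  match s with inl j => t * l 0 j | inr j => (1 - t) * m 0 j end.
pose z (s : 'I_d.+2 + 'I_d.+2) :=
  match s with inl j => X 0 j | inr j => Y 0 j end.
have := @comb_epi_of_comb _ w z (t * a + (1 - t) * b).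
rewrite !big_sumType /=.
have -> : \sum_i t * l 0 i + \sum_i (1 - t) * m 0 i = 1.
  by rewrite -!mulr_sumr l1 m1 !mulr1 addrC subrK.
under [X in X + _ <= _]eq_bigr do rewrite -mulrA.
under [X in _ + X <= _]eq_bigr do rewrite -mulrA.
under [X in comb_epi (X + _, _)]eq_bigr do rewrite -scalerA.
under [X in comb_epi (_ + X, _)]eq_bigr do rewrite -scalerA.
rewrite -!mulr_sumr -!scaler_sumr; apply => //.
- by case=> j; rewrite mulr_ge0 ?subr_ge0.
- by case=> j /=; [exact: SX|exact: SY].
- by rewrite lerD // ler_wpM2l ?subr_ge0.
Qed.

Hypotheses (cS : compact S)
  (lscf : lower_semicontinuous (EFin \o f : subspace S -> \bar R)).

Lemma lsc_near x a : S x -> a < f x -> \forall y \near x, S y -> a < f y.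
Proof.
move=> Sx afx; have afxE : (a%:E < (EFin \o f) x)%E by rewrite /= lte_fin.
have [V Vx Vf] := lscf afxE.
have : within S (nbhs x) V by rewrite nbhs_subspace_in.
by apply: filterS => y; exact: Vf.
Qed.

Lemma lsc_bounded_below : exists c, forall y, S y -> c < f y.
Proof.
have := (near_covering_withinP S).2 ((compact_near_coveringP S).1 cS) R
  (-oo) (fun c y => c < f y).
case=> [x Sx|M [_ SM]].
  near=> y c => /= Sy; apply: (@lt_trans _ _ (f x - 1)).
    by near: c; apply: nbhs_ninfty_lt; rewrite num_real.
  move: Sy; near: y; apply: lsc_near => //; lra.
by exists (M - 1) => y Sy; apply: (SM (M - 1)) => //; lra.
Unshelve. all: end_near. Qed.

(** Weights and points range over a compact set [K], and a point outside [comb_epi] has no witness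
    there. By the near-covering form of compactness, it is enough that each single non-witness
    remains one under small perturbations. *)
Lemma comb_epi_closed : closed comb_epi.
Proof.
have [c cf] := lsc_bounded_below.
have cK : compact ([set l : 'rV[R]_d.+2 | forall j, `[0, 1]%classic (l 0 j)] `*`
    [set X : 'rV['cV[R]_d]_d.+2 | forall j, S (X 0 j)]).
  apply: compact_setX.
    apply: (@rV_compact R _ (fun=> `[0, 1]%classic)) => i.
    exact: segment_compact.
  exact: (@rV_compact _ _ (fun=> S)).
set K := (X in compact X) in cK.
rewrite -openC openE => -[x a] nH; rewrite /interior.
(* [P p t] says that [t] is no witness for [p]. Subtracting the lower bound [c] makes every term of
   the value nonnegative, as [near_lt_mul] requires. *)
pose P (p : 'cV[R]_d * R^o) (t : 'rV[R]_d.+2 * 'rV['cV[R]_d]_d.+2) :=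
  ~ [/\ \sum_j t.1 0 j = 1,
    forall k, \sum_j t.1 0 j * t.2 0 j k 0 = p.1 k 0 &
    \sum_j t.1 0 j * (f (t.2 0 j) - c) <= p.2 - c].
have combE (l : 'rV[R]_d.+2) (X : 'rV['cV[R]_d]_d.+2) : \sum_j l 0 j = 1 ->
   \sum_j l 0 j * (f (X 0 j) - c) = \sum_j l 0 j * f (X 0 j) - c.
  move=> l1; under eq_bigr do rewrite mulrBr.
  by rewrite sumrB -mulr_suml l1 mul1r.
have O : nbhs (x, a) (fun p => K `<=` P p).
  have NC := (near_covering_withinP K).2 ((compact_near_coveringP K).1 cK).
  apply: (NC _ (nbhs (x, a)) P) => -[l X] Kt.
  pose Q := (('rV[R]_d.+2 * 'rV['cV[R]_d]_d.+2) * ('cV[R]_d * R^o))%type.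
  pose F := within [set q : Q | K q.1] (nbhs ((l, X), (x, a : R^o))).
  suff : \forall q \near F, P q.2 q.1 by [].
  have cFst : fst @ F --> (l, X) by apply: cvg_within_filter; exact: cvg_fst.
  have cSnd : snd @ F --> (x, a : R^o).
    by apply: cvg_within_filter; exact: cvg_snd.
  have cl j : (fun q : Q => q.1.1 0 j) @ F --> l 0 j.
    apply: (@cvg_comp _ _ _ (fun q : Q => q.1.1) (fun M => M 0 j) _ (nbhs l)).
      by apply: cvg_comp cFst _; exact: cvg_fst.
    exact: cvg_mx_coord.
  have cX j : (fun q : Q => q.1.2 0 j) @ F --> X 0 j.
    apply: (@cvg_comp _ _ _ (fun q : Q => q.1.2) (fun M => M 0 j) _ (nbhs X)).
      by apply: cvg_comp cFst _; exact: cvg_snd.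
    exact: cvg_mx_coord.
  have cXk j k : (fun q : Q => q.1.2 0 j k 0) @ F --> X 0 j k 0.
    apply: (@cvg_comp _ _ _ (fun q : Q => q.1.2 0 j) (fun M => M k 0) _ _ _
      (cX j)).
    exact: cvg_mx_coord.
  have cx k : (fun q : Q => q.2.1 k 0) @ F --> x k 0.
    apply: (@cvg_comp _ _ _ (fun q : Q => q.2.1) (fun M => M k 0) _ (nbhs x)).
      by apply: cvg_comp cSnd _; exact: cvg_fst.
    exact: cvg_mx_coord.
  have ca : (fun q : Q => q.2.2 : R) @ F --> (a : R).
    by apply: cvg_comp cSnd _; exact: cvg_snd.
  have FK : \forall q \near F, K q.1 by exact: withinT.
  have [l1|] := pselect (\sum_j l 0 j = 1); last first.
    move=> /(cvg_near_neq (cvg_sumr cl) (cvg_cst (1 : R))).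
    by apply: filterS => q nq [].
  have [lx|] :=
      pselect (forall k, \sum_j l 0 j * X 0 j k 0 = x k 0); last first.
    move=> /existsNP[k].
    move/(cvg_near_neq (cvg_sumr (fun j => cvgM (cl j) (cXk j k))) (cx k)).
    by apply: filterS => q nq [_ /(_ k)].
  (* Once both equalities hold, only the value inequality can fail; its strict failure persists by
     lower semicontinuity. *)
  have al : a - c < \sum_j l 0 j * (f (X 0 j) - c).
    rewrite ltNge combE // lerD2r; apply/negP => la; apply: nH.
    exists l, X; split => //.
    - by move=> j; have := Kt.1 j; rewrite /= in_itv /= => /andP[].
    - exact: Kt.2.
    - apply/colP => k; rewrite -lx summxE; apply: eq_bigr => j _.
      by rewrite mxE.
  have /near_lt_sum near_obj : forall j b, b < l 0 j * (f (X 0 j) - c) ->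
      F (fun q : Q => b < q.1.1 0 j * (f (q.1.2 0 j) - c)).
    move=> j; apply: (@near_lt_mul _ _ F _ (fun q : Q => q.1.1 0 j)
      (fun q : Q => f (q.1.2 0 j) - c)).
    - by rewrite subr_ge0 ltW // cf //; exact: Kt.2.
    - exact: cl.
    - apply: filterS FK => q [/(_ j) + _].
      by rewrite /= in_itv /= => /andP[].
    - by apply: filterS FK => q [_ /(_ j) Sq]; rewrite subr_ge0 ltW // cf.
    - move=> b; rewrite ltrBrDr => /(lsc_near (Kt.2 j))/cX nf.
      near=> q; rewrite ltrBrDr; have : K q.1 by near: q.
      by case=> _ /(_ j); near: q.
  pose m := ((a - c) + \sum_j l 0 j * (f (X 0 j) - c)) / 2.
  have am : a < m + c by rewrite /m; lra.
  have ml : m < \sum_j l 0 j * (f (X 0 j) - c) by rewrite /m; lra.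
  near=> q => -[_ _]; apply/negP; rewrite -ltNge.
  apply: (@lt_trans _ _ m).
    by rewrite ltrBlDr; near: q; exact: (cvgr_lt _ ca).
  by near: q; exact: near_obj.
apply: (filterS _ O) => -[y b] KP [l [Y [l0 l1 SY /= ly lb]]].
apply: (KP (l, Y)).
  split => //= j; rewrite /= in_itv /= l0 -l1 (bigD1 j) //= lerDl.
  exact: sumr_ge0.
split => //=; last by rewrite combE // lerD2r.
by move=> k; rewrite -ly summxE; apply: eq_bigr => j _; rewrite mxE.
Unshelve. all: end_near. Qed.

Lemma comb_epi_up x a b : comb_epi (x, a) -> a <= b -> comb_epi (x, b).
Proof.
move=> [l [X [l0 l1 SX lx la]]] ab; exists l, X; split => //.
exact: le_trans la ab.
Qed.

Lemma comb_epi_ge c x a : (forall y, S y -> c <= f y) -> comb_epi (x, a) ->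
  c <= a.
Proof.
move=> cf [l [X [l0 l1 SX lx /= la]]]; apply: le_trans la.
rewrite -[leLHS]mul1r -l1 mulr_suml; apply: ler_sum => j _.
by rewrite ler_wpM2l // cf.
Qed.

Lemma comb_epi_self x : S x -> comb_epi (x, f x).
Proof.
move=> Sx; have := @comb_epi_of_comb 'I_1 (fun=> 1) (fun=> x) (f x).
by rewrite !big_ord1 scale1r mul1r; apply.
Qed.

(** The lower boundary of [comb_epi], a competitor in the supremum that defines
    [convex_envelope]. *)
Definition comb_env (x : 'cV[R]_d) : \bar R :=
  ereal_inf [set a%:E | a in [set a | comb_epi (x, a)]].

(** The infimum is attained by closedness: points [(x, a + e / 2)] of [comb_epi] come arbitrarily
    close to [(x, a)]. *)
Lemma epigraph_comb_env : epigraph comb_env = comb_epi.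
Proof.
apply/seteqP; split=> -[x a] /=; last first.
  by move=> xa; apply: ereal_inf_lbound; exists a.
move=> xa; apply: comb_epi_closed => B /= [[B1 B2] /= [B1x B2a] BB].
have [e /= e0 eB2] : \forall e \near 0^'+, B2 (a + e).
  have : (fun e : R => a + e) @ 0^'+ --> a + 0.
    apply: cvg_at_right_filter; apply: cvgD; [exact: cvg_cst|exact: cvg_id].
  by rewrite addr0; exact.
have e20 : 0 < e / 2 by rewrite divr_gt0.
have : (comb_env x < (a + e / 2)%:E)%E.
  by apply: le_lt_trans xa _; rewrite lte_fin ltrDl.
move=> /ereal_inf_lt[_ [b xb <-]]; rewrite lte_fin => bae.
exists (x, a + e / 2); split; first exact: comb_epi_up xb (ltW bae).
apply: BB; split => /=; first exact: nbhs_singleton.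
apply: eB2 => //=; rewrite sub0r normrN gtr0_norm //; lra.
Qed.

Lemma comb_env_minorant : closed_convex_minorant (ext_fun S f) comb_env.
Proof.
split; first split.
- move=> x; have [c cf] := lsc_bounded_below.
  rewrite -ltNye; apply: (@lt_le_trans _ _ c%:E); first exact: ltNyr.
  apply/ereal_infP => _ [a xa <-]; rewrite lee_fin.
  by apply: comb_epi_ge xa => y /cf/ltW.
- by rewrite epigraph_comb_env; exact: comb_epi_convex.
- by rewrite epigraph_comb_env; exact: comb_epi_closed.
- move=> x; rewrite /ext_fun /pinfty_outside; case: ifPn; last by rewrite leey.
  rewrite inE => Sx; apply: ereal_inf_lbound; exists (f x) => //.
  exact: comb_epi_self.
Qed.

Lemma conv_hull_comb x : conv_hull S x <-> exists a, comb_epi (x, a).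
Proof.
split; last first.
  move=> [a [l [X [l0 l1 SX /= <- _]]]] C [cC SC].
  by apply: convex_set_sum => // j; exact: SC.
apply: (smallest_sub (X := [set x | exists a, comb_epi (x, a)])).
  apply/convex_setP => y z t t0 t1 [a ya] [b zb].
  exists (t * a + (1 - t) * b).
  exact: ((convex_setP _).1 comb_epi_convex _ _ t t0 t1 ya zb).
by move=> y Sy; exists (f y); exact: comb_epi_self.
Qed.

(** [comb_env] is a closed convex minorant, so it bounds the envelope from below; conversely, the
    epigraph of every such minorant contains the points [(X 0 j, f (X 0 j))] and hence their convex
    combinations. Most later facts on the envelope go through this equivalence. *)
Lemma ext_envelope_leP x a :
  (ext_envelope S f x <= a%:E)%E <-> comb_epi (x, a).
Proof.
rewrite /ext_envelope /pinfty_outside; split.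
  case: ifPn => [_ xa|]; last by rewrite leye_eq.
  suff : epigraph comb_env (x, a) by rewrite epigraph_comb_env.
  apply: le_trans xa; apply: ereal_sup_ubound; exists comb_env => //.
  exact: comb_env_minorant.
move=> xa; rewrite ifT; last by rewrite inE; apply/conv_hull_comb; exists a.
apply: ge_ereal_sup => _ [g [[_ cg _] gf] <-].
have [l [X [l0 l1 SX /= lx la]]] := xa.
have : epigraph g (\sum_j l 0 j *: ((X 0 j, f (X 0 j)) : 'cV[R]_d * R^o)%type).
  apply: convex_set_sum => // j /=; apply: le_trans (gf _) _.
  by rewrite /ext_fun /pinfty_outside /= ifT // inE.
have -> : \sum_j l 0 j *: ((X 0 j, f (X 0 j)) : 'cV[R]_d * R^o)%type =
    (x, \sum_j l 0 j * f (X 0 j)).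
  rewrite -lx; elim/big_rec3: _ => // j y1 y2 y3 _ -> //.
by move=> /le_trans; apply; rewrite lee_fin.
Qed.

Lemma ext_envelope_bounded_below :
  exists c, forall x, (c%:E <= ext_envelope S f x)%E.
Proof.
have [c cf] := lsc_bounded_below; exists (c - 1) => x.
rewrite leNgt; apply/negP => /ltW/ext_envelope_leP/(comb_epi_ge _) cc.
have : c <= c - 1 by apply: cc => y /cf/ltW.
by lra.
Qed.

Lemma ext_envelope_le x : (ext_envelope S f x <= ext_fun S f x)%E.
Proof.
rewrite [leRHS]/ext_fun /pinfty_outside; case: ifPn; last by rewrite leey.
by rewrite inE => Sx; apply/ext_envelope_leP; exact: comb_epi_self.
Qed.

Lemma comb_epi_bounded :
  exists M, forall x a, comb_epi (x, a) -> forall k, `|x k 0| <= M.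
Proof.
have /compact_bounded [M [_ SM]] := cS.
exists (M + 1) => x a [l [X [l0 l1 SX /= <- _]]] k.
rewrite summxE (le_trans (ler_norm_sum _ _ _)) //.
rewrite -[leRHS]mul1r -[X in X * _]l1 mulr_suml; apply: ler_sum => j _.
rewrite mxE normrM ger0_norm // ler_wpM2l //.
have : `|X 0 j| <= M + 1 by apply: (SM (M + 1)) => //; lra.
move=> XM; apply: (le_trans _ XM).
exact: coord_le_norm.
Qed.

(** A combination attaining the envelope at [x] has a point [X 0 j] other than [x] with positive
    weight. Shifting weight to or from this point moves [x] along a line and changes the value
    affinely. *)
Lemma ext_envelope_affine_direction x :
  (ext_envelope S f x < +oo)%E -> ext_envelope S f x != ext_fun S f x ->
  exists (v : 'cV[R]_d) (g e : R), [/\ v != 0, 0 < e &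
    forall t, `|t| <= e -> (ext_envelope S f (x + t *: v)%R <=
      ext_envelope S f x + (t * g)%:E)%E].
Proof.
have [c cx] := ext_envelope_bounded_below; move: (cx x).
case E : (ext_envelope S f x) => [a| |] // _ _ aNf.
have [l [X [l0 l1 SX /= lx la]]] : comb_epi (x, a).
  by apply/ext_envelope_leP; rewrite E.
have {}la : \sum_j l 0 j * f (X 0 j) = a.
  apply/eqP; rewrite eq_le la /= -lee_fin -E; apply/ext_envelope_leP.
  by exists l, X; split.
have [j [lj Xj]] : exists j, 0 < l 0 j /\ X 0 j != x.
  apply: contrapT => /forallNP nj.
  have Xx k : l 0 k != 0 -> X 0 k = x.
    move=> lk; apply/eqP; apply: contrapT => /negP Xk; apply: (nj k).
    by rewrite lt_neqAle eq_sym lk l0.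
  have [k lk] : exists k, l 0 k != 0.
    apply: contrapT => /forallNP n0; have := oner_neq0 R.
    rewrite -l1 big1 ?eqxx // => k _; apply/eqP.
    by have /negP := n0 k; rewrite negbK.
  move/negP: aNf; apply; rewrite /ext_fun /pinfty_outside ifT; last first.
    by rewrite inE -(Xx k lk).
  rewrite /= -la eqe; apply/eqP; rewrite -[RHS]mul1r -l1 mulr_suml.
  apply: eq_bigr => i _; have [->|/Xx ->//] := eqVneq (l 0 i) 0.
  by rewrite !mul0r.
have lj1 : l 0 j <= 1.
  by rewrite -l1 (bigD1 j) //= lerDl; exact: sumr_ge0.
(* The radius is the weight of [X 0 j]: it keeps that weight nonnegative when [t < 0] and, being at
   most 1, it keeps [1 - t] nonnegative. *)
exists (X 0 j - x), (f (X 0 j) - a), (l 0 j); split; rewrite ?subr_eq0 //.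
move=> t tl; rewrite -EFinD; apply/ext_envelope_leP.
pose m := \row_k ((1 - t) * l 0 k + t * (k == j)%:R) : 'rV[R]_d.+2.
(* One identity gives the total weight, the barycentre and the value, for three choices of [F]. *)
have pick (V : lmodType R) (F : 'I_d.+2 -> V) :
    \sum_k m 0 k *: F k = (1 - t) *: (\sum_k l 0 k *: F k) + t *: F j.
  under eq_bigr do rewrite mxE scalerDl -!scalerA.
  rewrite big_split /= -!scaler_sumr; congr (_ + _ *: _).
  rewrite (bigD1 j) //= eqxx scale1r big1 ?addr0 // => k /negbTE ->.
  by rewrite scale0r.
exists m, X; split => //=.
- move=> k; rewrite mxE; case: eqP => [->|_]; last first.
    rewrite mulr0 addr0 mulr_ge0 // subr_ge0.
    by rewrite (le_trans (ler_norm _)) // (le_trans tl).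
  rewrite mulr1; have := tl; rewrite ler_norml => /andP[tl1 tl2].
  have [t0|t0] := leP 0 t; nra.
- have := pick R^o (fun=> 1); rewrite /GRing.scale /=.
  under eq_bigr do rewrite mulr1.
  move=> ->; under eq_bigr do rewrite mulr1.
  by rewrite l1; ring.
- by rewrite pick lx scalerBl scale1r scalerBr addrCA addrC -addrA.
- have := pick R^o (fun k => f (X 0 k)); rewrite /GRing.scale /= => ->.
  by rewrite la le_eqVlt; apply/orP; left; apply/eqP; ring.
Qed.
End ComponentEnvelope.

(** * Small rotations *)

Section DotProduct.
Context {R : realType} {N : nat}.
Implicit Types u v w x y : 'cV[R]_N.

Lemma dotpE u v : dotp u v = \sum_k u k 0 * v k 0.
Proof. by rewrite /dotp mxE; apply: eq_bigr => k _; rewrite mxE. Qed.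

Lemma dotpC u v : dotp u v = dotp v u.
Proof. by rewrite !dotpE; apply: eq_bigr => k _; rewrite mulrC. Qed.

Lemma dotpDl u v w : dotp (u + v) w = dotp u w + dotp v w.
Proof. by rewrite /dotp linearD mulmxDl mxE. Qed.

Lemma dotpZl a u v : dotp (a *: u) v = a * dotp u v.
Proof. by rewrite /dotp linearZ -scalemxAl mxE. Qed.

Lemma dotpDr u v w : dotp u (v + w) = dotp u v + dotp u w.
Proof. by rewrite /dotp mulmxDr mxE. Qed.

Lemma dotpBr u v w : dotp u (v - w) = dotp u v - dotp u w.
Proof. by rewrite /dotp mulmxBr !mxE. Qed.

Lemma dotpZr a u v : dotp u (a *: v) = a * dotp u v.
Proof. by rewrite dotpC dotpZl dotpC. Qed.

Lemma dotp_mulmx_bound (M : 'M[R]_N) v x a b : (forall k, `|v k 0| <= a) ->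
  (forall k, `|x k 0| <= b) ->
  `|dotp (M *m v) x| <= (\sum_k \sum_l `|M k l|) * a * b.
Proof.
move=> va xb; rewrite dotpE (le_trans (ler_norm_sum _ _ _)) // !mulr_suml.
apply: ler_sum => k _; rewrite normrM.
have a0 : 0 <= a by exact: le_trans (va k).
apply: ler_pM => //; rewrite mxE (le_trans (ler_norm_sum _ _ _)) // mulr_suml.
by apply: ler_sum => l _; rewrite normrM ler_wpM2l.
Qed.

Lemma sphere_coord_le1 v k : dotp v v = 1 -> `|v k 0| <= 1.
Proof.
rewrite dotpE => v1; rewrite -(@ler_pXn2r _ 2) ?nnegrE // expr1n.
rewrite -normrX ger0_norm ?sqr_ge0 // -v1 (bigD1 k) //= expr2 lerDl.
by apply: sumr_ge0 => l _; rewrite -expr2 sqr_ge0.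
Qed.

Lemma cvg_col_coord T (F : set_system T) {FF : Filter F}
    (f : T -> 'cV[R]_N) u k :
  f @ F --> u -> (fun t => f t k 0) @ F --> u k 0.
Proof.
move=> fu; apply: (@cvg_comp _ _ _ f (fun M : 'cV[R]_N => M k 0) _ (nbhs u)).
  exact: fu.
exact: cvg_mx_coord.
Qed.

Lemma cvg_dotp T (F : set_system T) {FF : Filter F} (f g : T -> 'cV[R]_N) u v :
  f @ F --> u -> g @ F --> v -> (fun t => dotp (f t) (g t)) @ F --> dotp u v.
Proof.
move=> fu gv.
have -> : (fun t => dotp (f t) (g t)) = (fun t => \sum_k f t k 0 * g t k 0).
  by apply: funext => t; rewrite dotpE.
rewrite dotpE; apply: cvg_sumr => k; apply: cvgM; exact: cvg_col_coord.
Qed.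

End DotProduct.

Lemma cvg_colP (R : realType) n T (F : set_system T) {FF : Filter F}
    (f : T -> 'cV[R]_n) (u : 'cV[R]_n) :
  (forall k, (fun t => f t k 0) @ F --> u k 0) -> f @ F --> u.
Proof.
move=> fu A [B Bu BA].
have : \forall t \near F, forall i j, B i j (f t i j).
  apply: filter_forall => i; apply: filter_forall => j.
  by rewrite ord1; apply: fu; exact: Bu.
by apply: filterS => t; exact: BA.
Qed.

Lemma continuous_mulmx (R : realType) m n (M : 'M[R]_(m, n)) :
  continuous (fun y : 'cV[R]_n => M *m y).
Proof.
move=> x; apply: (@cvg_colP _ _ _ (nbhs x)) => i; rewrite mxE.
have -> : (fun y : 'cV[R]_n => (M *m y) i 0) =
    (fun y => \sum_k M i k * y k 0) by apply: funext => y; rewrite mxE.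
apply: cvg_sumr => k; apply: cvgMl_tmp.
by apply: cvg_col_coord; exact: cvg_id.
Qed.

Section SmallRotations.
Context {R : realType} {N : nat}.
Variable J : 'M[R]_N.
Hypotheses (JT : J^T = - J) (JJJ : J *m J *m J = - J).

(* The Cayley transform (1 + tJ)(1 - tJ)^-1, simplified using J^3 = -J. *)
Definition cayley (t : R) : 'M[R]_N :=
  1%:M + (t *+ 2 / (1 + t ^+ 2)) *: (J + t *: (J *m J)).

Lemma sqr1D_gt0 (t : R) : 0 < 1 + t ^+ 2.
Proof. by rewrite ltr_pwDl // sqr_ge0. Qed.

(** On the range of [J], where [J *m J] acts as minus the identity, [cayley t] is the rotation by
    [2 arctan t]; on the kernel of [J] it is the identity. *)
Lemma cayley_orthogonal t : (cayley t)^T *m cayley t = 1%:M.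
Proof.
have JJJJ : J *m J *m (J *m J) = - (J *m J) by rewrite mulmxA JJJ mulNmx.
have JJ_J : J *m (J *m J) = - J by rewrite mulmxA.
rewrite /cayley; set s := t *+ 2 / _.
have -> : (1%:M + s *: (J + t *: (J *m J)))^T =
    1%:M + s *: (- J + t *: (J *m J)) :> 'M[R]_N.
  have JJT : (J *m J)^T = J *m J by rewrite trmx_mul JT mulNmx mulmxN opprK.
  move: (J *m J) JJT => D DT; apply/matrixP => a b.
  have := congr1 (fun M : 'M[R]_N => M a b) JT.
  have := congr1 (fun M : 'M[R]_N => M a b) DT.
  by rewrite !mxE eq_sym => -> ->.
rewrite !(mulmxDl, mulmxDr, mul1mx, mulmx1) -!(scalemxAl, scalemxAr).
rewrite !(mulmxDl, mulmxDr) -!(scalemxAl, scalemxAr) !mulNmx JJJJ JJJ JJ_J.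
move: (J *m J) (1%:M : 'M[R]_N) => D I1; apply/matrixP => a b; rewrite !mxE /s.
by field; rewrite gt_eqF // sqr1D_gt0.
Qed.

(** The component of [w] in the kernel of [J] cancels. On the range, a chord of a circle is
    perpendicular to the sum of its endpoints, and the factor is the tangent of half the angle
    between them. *)
Lemma cayley_chord (t1 t2 : R) (w : 'cV[R]_N) : 0 <= t1 -> t1 < t2 ->
  cayley t2 *m w - cayley t1 *m w =
  ((t2 - t1) / (1 + t1 * t2)) *: (J *m (cayley t1 *m w + cayley t2 *m w)).
Proof.
move=> t10 t12.
have JJ_J : J *m (J *m J) = - J by rewrite mulmxA.
have tt : 1 + t1 * t2 != 0.
  by rewrite gt_eqF // ltr_pwDl // mulr_ge0 // (le_trans t10) // ltW.
rewrite -mulmxDl -mulmxBl mulmxA scalemxAl; congr (_ *m _).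
rewrite /cayley !mulmxDr !mulmx1 -!scalemxAr !mulmxDr -!scalemxAr JJ_J.
move: (J *m J) (1%:M : 'M[R]_N) => D I1; apply/matrixP => a b; rewrite !mxE.
by field; rewrite tt !gt_eqF // sqr1D_gt0.
Qed.

(* A minimizer x2 at w2 and a minimizer y1 at w1 satisfy
   (w2 - w1) . (x2 - y1) <= 0, and w2 - w1 is a positive multiple of
   J (w1 + w2), so the slopes along J w cannot increase much. *)
Lemma cayley_minimizer_slopes (K : set 'cV[R]_N) (M t1 t2 p q : R)
    (w x2 y1 : 'cV[R]_N) :
  0 <= M -> (forall x, K x -> forall k, `|x k 0| <= M) ->
  0 <= t1 -> t1 < t2 ->
  let w1 := cayley t1 *m w in let w2 := cayley t2 *m w in
  dotp w1 w1 = 1 -> dotp w2 w2 = 1 ->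
  is_minimizer K (dotp w2) x2 -> is_minimizer K (dotp w1) y1 ->
  q <= dotp (J *m w2) x2 -> dotp (J *m w1) y1 <= p ->
  q - p <= (t2 - t1) * ((\sum_k \sum_l `|(J *m J) k l|) * M *+ 2).
Proof.
move=> M0 KM t10 t12 w1 w2 w11 w21 [Kx2 x2min] [Ky1 y1min] qx2 y1p.
set T := (t2 - t1) / (1 + t1 * t2).
have tt : 1 <= 1 + t1 * t2.
  by rewrite lerDl mulr_ge0 // (le_trans t10) // ltW.
have T0 : 0 < T by rewrite divr_gt0 ?subr_gt0 // (lt_le_trans _ tt).
have TT : T <= t2 - t1.
  by rewrite ler_pdivrMr ?(lt_le_trans _ tt) // ler_peMr // subr_ge0 ltW.
have chord : w2 = w1 + T *: (J *m (w1 + w2)).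
  by rewrite -cayley_chord // addrC subrK.
have dotw2 z : dotp w2 z = dotp w1 z + T * dotp (J *m (w1 + w2)) z.
  by rewrite {1}chord dotpDl dotpZl.
have := y1min _ Kx2; have := x2min _ Ky1; rewrite !dotw2.
set a := dotp (J *m (w1 + w2)) _; set b := dotp (J *m (w1 + w2)) _.
move=> le1 le2.
have ab : a <= b by rewrite -(ler_pM2l T0); lra.
have Jw : J *m w2 = J *m w1 + T *: (J *m J *m (w1 + w2)).
  by rewrite {1}chord mulmxDr -scalemxAr !mulmxA.
have := dotp_mulmx_bound (J *m J) (v := w1 + w2) (x := x2 + y1)
  (a := 2) (b := M *+ 2) _ _.
set C := \sum_k _; set D := dotp _ _ => DC.
have {}DC : D <= C * 2 * (M *+ 2).
  apply: le_trans (ler_norm _) (DC _ _) => k; rewrite mxE.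
    rewrite (le_trans (ler_normD _ _)) // -[2]/(1 + 1).
    by rewrite lerD // sphere_coord_le1.
  by rewrite (le_trans (ler_normD _ _)) // mulr2n lerD // KM.
move: ab; rewrite /a /b mulmxDr !dotpDl => ab.
have e1 : dotp (J *m w2) x2 =
    dotp (J *m w1) x2 + T * dotp (J *m J *m (w1 + w2)) x2.
  by rewrite {1}Jw dotpDl dotpZl.
have e2 : dotp (J *m w2) y1 =
    dotp (J *m w1) y1 + T * dotp (J *m J *m (w1 + w2)) y1.
  by rewrite {1}Jw dotpDl dotpZl.
have D2 : D = dotp (J *m J *m (w1 + w2)) x2 + dotp (J *m J *m (w1 + w2)) y1.
  by rewrite /D dotpDr.
pose B := C * M *+ 2.
have B0 : 0 <= B.
  rewrite mulrn_wge0 // mulr_ge0 // sumr_ge0 // => k _.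
  by apply: sumr_ge0 => l _.
have {}DC : D <= 2 * B by rewrite (_ : 2 * B = C * 2 * (M *+ 2)) // /B; ring.
(* Doubling the two slope bounds lets [ab] cancel all terms in [J]; only those in [J *m J]
   remain. *)
have qD : 2 * (q - p) <= T * D by rewrite D2; lra.
have TD : T * D <= T * (2 * B) by rewrite ler_pM2l.
have TB : T * B <= (t2 - t1) * B by rewrite ler_wpM2r.
rewrite -(ler_pM2l (ltr0Sn R 1)); apply: le_trans qD (le_trans TD _).
by rewrite mulrCA ler_pM2l.
Qed.
End SmallRotations.

(** * Almost sure uniqueness of minimizers *)

Lemma closed_measurable_borel (R : realType) N (B : set 'cV[R]_N) :
  closed B -> measurable (B : set (borel_cV R N)).
Proof.
move=> cB; rewrite -[B]setCK; apply: measurableC.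
by apply: sub_sigma_algebra; exact: closed_openC.
Qed.

Section UniqueMinimizer.
Context {R : realType} {N : nat}.
Variable K : set 'cV[R]_N.
Hypothesis cK : compact K.

(** The sphere condition and the weak inequalities make this set closed, hence Borel. *)
Definition split_minimizers (J : 'M[R]_N) (p q : R) : set 'cV[R]_N :=
  [set w | dotp w w = 1 /\ exists x y, [/\ is_minimizer K (dotp w) x,
    is_minimizer K (dotp w) y, q <= dotp (J *m w) x & dotp (J *m w) y <= p]].

(** A pair in [K] that violates one of the conditions at [w0] violates it strictly, hence also for
    nearby pairs and nearby [w]; compactness makes this uniform over all pairs. *)
Lemma near_notin_split_minimizers J p q (F0 : set_system 'cV[R]_N)
    {FF : Filter F0} (w0 : 'cV[R]_N) : F0 --> w0 ->
  ~ split_minimizers J p q w0 -> F0 (~` split_minimizers J p q).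
Proof.
move=> Fw0 nw0.
have [w1|w1] := pselect (dotp w0 w0 = 1); last first.
  have idw : (fun w : 'cV[R]_N => w) @ F0 --> w0 by exact: Fw0.
  have : \forall w \near F0, dotp w w <> 1.
    by apply: cvg_near_neq w1; [exact: cvg_dotp|exact: cvg_cst].
  by apply: filterS => w nw [].
pose P (w : 'cV[R]_N) (z : 'cV[R]_N * 'cV[R]_N) :=
  ~ [/\ forall y, K y -> dotp w z.1 <= dotp w y,
      forall y, K y -> dotp w z.2 <= dotp w y,
      q <= dotp (J *m w) z.1 & dotp (J *m w) z.2 <= p].
suff : F0 (fun w => K `*` K `<=` P w).
  apply: filterS => w KP [_ [x [y [[Kx xm] [Ky ym] qx yp]]]].
  by apply: (KP (x, y)).
have NC := (compact_near_coveringP (K `*` K)).1 (compact_setX cK cK).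
apply: (NC _ F0 P) => -[x0 y0] [/= Kx0 Ky0].
pose Q := (('cV[R]_N * 'cV[R]_N) * 'cV[R]_N)%type.
pose F := filter_prod (nbhs (x0, y0)) F0.
suff : F (fun q : Q => P q.2 q.1) by [].
have cx : (fun q : Q => q.1.1) @ F --> x0.
  apply: (@cvg_comp _ _ _ fst fst _ (nbhs (x0, y0))); exact: cvg_fst.
have cy : (fun q : Q => q.1.2) @ F --> y0.
  apply: (@cvg_comp _ _ _ fst snd _ (nbhs (x0, y0))); first exact: cvg_fst.
  exact: cvg_snd.
have cw : (fun q : Q => q.2) @ F --> w0.
  by apply: cvg_trans Fw0; exact: cvg_snd.
have cJ : (fun q : Q => J *m q.2) @ F --> J *m w0.
  apply: (@cvg_comp _ _ _ snd (fun w => J *m w) _ (nbhs w0)); first exact: cw.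
  exact: continuous_mulmx.
have cst z : (fun _ : Q => z) @ F --> (z : 'cV[R]_N) by exact: cvg_cst.
have near_lt (f g : Q -> R) a b : f @ F --> a -> g @ F --> b -> a < b ->
    F (fun q => f q < g q).
  move=> fa gb ab; near=> z; apply: (@lt_trans _ _ ((a + b) / 2)).
    by near: z; apply: (cvgr_lt _ fa); lra.
  by near: z; apply: (cvgr_gt _ gb); lra.
have [xm|/existsNP[z /not_implyP[Kz /negP]]] :=
    pselect (forall y, K y -> dotp w0 x0 <= dotp w0 y); last first.
  rewrite -ltNge => /(near_lt _ _ _ _ (cvg_dotp cw (cst z)) (cvg_dotp cw cx)).
  by apply: filterS => -[[x y] w] /= + [/(_ _ Kz)]; rewrite ltNge => /negP.
have [ym|/existsNP[z /not_implyP[Kz /negP]]] :=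
    pselect (forall y, K y -> dotp w0 y0 <= dotp w0 y); last first.
  rewrite -ltNge => /(near_lt _ _ _ _ (cvg_dotp cw (cst z)) (cvg_dotp cw cy)).
  by apply: filterS => -[[x y] w] /= + [_ /(_ _ Kz)]; rewrite ltNge => /negP.
have [qx|] := leP q (dotp (J *m w0) x0); last first.
  move/(near_lt _ _ _ _ (cvg_dotp cJ cx) (cvg_cst q)).
  by apply: filterS => -[[x y] w] /= + [_ _ + _]; rewrite ltNge => /negP.
have [yp|] := leP (dotp (J *m w0) y0) p; last first.
  move/(near_lt _ _ _ _ (cvg_cst p) (cvg_dotp cJ cy)).
  by apply: filterS => -[[x y] w] /= + [_ _ _]; rewrite ltNge => /negP.
by exfalso; apply: nw0; split => //; exists x0, y0; split.
Unshelve. all: end_near. Qed.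

Lemma split_minimizers_closed J p q : closed (split_minimizers J p q).
Proof.
rewrite -openC openE => w0 nw0.
by apply: (@near_notin_split_minimizers _ _ _ (nbhs w0)) nw0; exact: cvg_id.
Qed.

Variable mu : probability (borel_cV R N) R.
Hypothesis mu_uniform : uniform_on_sphere mu.

Lemma split_minimizers_null (J : 'M[R]_N) (p q : R) :
  J^T = - J -> J *m J *m J = - J -> p < q -> mu (split_minimizers J p q) = 0%E.
Proof.
move=> JT JJJ pq; set B := split_minimizers J p q.
have mB : measurable (B : set (borel_cV R N)).
  by apply: closed_measurable_borel; exact: split_minimizers_closed.
have [M M0 KM] : exists2 M, 0 <= M &
    forall x, K x -> forall k, `|x k 0| <= M.
  have [M [_ HM]] := compact_bounded cK.
  exists (`|M| + 1); first by rewrite addr_ge0.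
  move=> x Kx k; have : `|x| <= `|M| + 1.
    by apply: (HM (`|M| + 1)) => //; rewrite ltr_pwDr // ler_norm.
  apply: le_trans; exact: coord_le_norm.
set C := (\sum_k \sum_l `|(J *m J) k l|) * M *+ 2.
have C0 : 0 <= C.
  rewrite mulrn_wge0 // mulr_ge0 // sumr_ge0 // => k _.
  by apply: sumr_ge0 => l _.
have [r r0 muB] : exists2 r, 0 <= r & mu B = r%:E.
  exists (fine (mu B)); first by rewrite fine_ge0 // measure_ge0.
  rewrite fineK // ge0_fin_numE ?measure_ge0 //.
  by apply: le_lt_trans (ltry 1); exact: probability_le1.
(* k rotated copies of B are pairwise disjoint and have the measure of B. *)
have kmu (k : nat) : k%:R * r <= 1.
  (* The rotation parameters [l%:R * e] with [l < k] differ by at most [k%:R * e], and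
     [k%:R * e * C < q - p]; [k.+1] and [C + 1] keep the denominator positive. *)
  pose e := (q - p) / (k.+1%:R * (C + 1)).
  have e0 : 0 < e by rewrite divr_gt0 ?subr_gt0 // mulr_gt0 // ltr_wpDl.
  have keC : k%:R * e * C < q - p.
    have -> : q - p = k.+1%:R * e * (C + 1).
      by rewrite mulrAC mulrC divfK // gt_eqF // mulr_gt0 // ltr_wpDl.
    apply: (@le_lt_trans _ _ (k.+1%:R * e * C)).
      by rewrite ler_wpM2r // ler_pM2r // ler_nat.
    by rewrite ltr_pM2l ?ltrDl // mulr_gt0.
  pose A (l : 'I_k) : set (borel_cV R N) :=
    (fun w : borel_cV R N => cayley J (l%:R * e) *m w : borel_cV R N) @^-1` B.
  have mA l : measurable (A l).
    apply: closed_measurable_borel; apply: preimage_closed.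
      by move=> w _; exact: continuous_mulmx.
    exact: split_minimizers_closed.
  have muA l : mu (A l) = mu B.
    by apply: mu_uniform.2 => //; exact: cayley_orthogonal.
  have tA : trivIset setT A.
    have disj (i j : 'I_k) : (i < j)%N -> A i `&` A j = set0.
      move=> ij; rewrite -subset0 => w [/= [w11 [_ [y1 [_ y1m _ y1p]]]]
        [w21 [x2 [_ [x2m _ x2q _]]]]].
      have ij' : i%:R * e < j%:R * e by rewrite ltr_pM2r // ltr_nat.
      have i0 : 0 <= i%:R * e by rewrite mulr_ge0 // ltW.
      (* A common point would have a slope at most [p] at the smaller parameter and at least [q] at
         the larger one, too large an increase for so small a rotation. *)
      have := cayley_minimizer_slopes JJJ M0 KM i0 ij' w11 w21 x2m y1m x2q y1p.
      apply/negP; rewrite -ltNge -/C.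
      have : (j%:R * e - i%:R * e) <= k%:R * e.
        by rewrite -mulrBl ler_pM2r // lerBlDr ler_wpDr // ler_nat ltnW.
      move=> /(ler_wpM2r C0)/le_lt_trans; apply.
      exact: keC.
    apply/trivIsetP => i j _ _; rewrite neq_ltn => /orP[|ji]; first exact: disj.
    by rewrite setIC; exact: disj.
  have := probability_le1 mu (bigsetU_measurable _ (fun l _ => mA l)
    : measurable (\big[setU/set0]_(l < k) A l)).
  rewrite measure_bigsetU_ord // (eq_bigr (fun=> mu B)) => [|l _]; last first.
    exact: muA.
  by rewrite muB sumEFin lee_fin sumr_const card_ord mulr_natl.
rewrite muB; congr EFin.
apply/eqP; rewrite eq_le r0 andbT leNgt; apply/negP => r1.
have := kmu (Num.bound r^-1); apply/negP; rewrite -ltNge.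
by rewrite -ltr_pdivrMr // mul1r archi_boundP // invr_ge0.
Qed.

End UniqueMinimizer.

(** The infinitesimal rotation in the plane of coordinates [i] and [j]; applied to a unit vector
    [w], these matrices span the tangent space of the sphere at [w]. *)
Definition plane_generator (R : realType) N (i j : 'I_N) : 'M[R]_N :=
  delta_mx i j - delta_mx j i.

Lemma plane_generatorT (R : realType) N (i j : 'I_N) :
  (plane_generator R i j)^T = - plane_generator R i j.
Proof. by rewrite linearB /= !trmx_delta opprB. Qed.

Lemma plane_generator_cube (R : realType) N (i j : 'I_N) : i != j ->
  let J := plane_generator R i j in J *m J *m J = - J.
Proof.
move=> /negbTE ij J; have ji : (j == i) = false by rewrite eq_sym.
rewrite /J /plane_generator !(mulmxBl, mulmxBr, mul_delta_mx_cond) ij ji !eqxx.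
rewrite !mulr1n !mulr0n !(mul0mx, mul_delta_mx_cond) ij ji !eqxx.
rewrite !mulr1n !mulr0n.
by rewrite !(oppr0, subr0, sub0r, add0r, addr0, opprK) ?opprB addrC.
Qed.

Lemma dotp_plane_generator (R : realType) N (i j : 'I_N) (w x : 'cV[R]_N) :
  dotp (plane_generator R i j *m w) x = w j 0 * x i 0 - w i 0 * x j 0.
Proof.
have delta k l : dotp (delta_mx k l *m w) x = w l 0 * x k 0.
  rewrite dotpE (bigD1 k) //= big1 ?addr0 => [|m mk]; rewrite !mxE.
    rewrite (bigD1 l) //= big1 ?addr0 => [|m ml]; rewrite !mxE !eqxx ?mul1r //.
    by rewrite (negbTE ml) andbF mul0r.
  by rewrite big1 ?mul0r // => n _; rewrite mxE (negbTE mk) mul0r.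
rewrite /plane_generator mulmxBl -[X in _ + X]scaleN1r dotpDl dotpZl !delta.
by rewrite mulN1r.
Qed.

(** The difference of two minimizers is orthogonal to [w]. If no plane generator tells them apart,
    it is also parallel to [w], hence zero; otherwise two rationals fit strictly between the
    slopes. *)
Lemma unique_off_split_minimizers (R : realType) N (K : set 'cV[R]_N)
    (w x y : 'cV[R]_N) : dotp w w = 1 ->
  (forall i j (p q : rat), i != j -> p < q ->
    ~ split_minimizers K (plane_generator R i j) (ratr p) (ratr q) w) ->
  is_minimizer K (dotp w) x -> is_minimizer K (dotp w) y -> x = y.
Proof.
move=> w1 nsplit xm ym.
have wxy : dotp w (x - y) = 0.
  apply/eqP; rewrite dotpBr subr_eq0.
  by rewrite eq_le (xm.2 _ ym.1) (ym.2 _ xm.1).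
have [] := pselect (forall i j, w j 0 * (x - y) i 0 = w i 0 * (x - y) j 0).
  move=> wv; apply/eqP; rewrite -subr_eq0; apply/eqP/colP => i.
  rewrite -[LHS]mul1r -w1 dotpE mulr_suml [RHS]mxE.
  under eq_bigr do rewrite -mulrA wv mulrCA.
  by rewrite -mulr_sumr -dotpE wxy mulr0.
move=> /existsNP[i /existsNP[j /eqP wij]]; exfalso.
have ij : i != j by apply: contra wij => /eqP ->.
pose J := plane_generator R i j.
have split z1 z2 : is_minimizer K (dotp w) z1 -> is_minimizer K (dotp w) z2 ->
    ~ (dotp (J *m w) z2 < dotp (J *m w) z1).
  move=> z1m z2m /rat_in_itvoo[q]; rewrite in_itv /= => /andP[z2q qz1].
  have [p] := rat_in_itvoo z2q; rewrite in_itv /= => /andP[z2p pq].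
  apply: (nsplit i j p q ij); first by rewrite -(ltr_rat R).
  by split => //; exists z1, z2; split => //; exact: ltW.
have : dotp (J *m w) x != dotp (J *m w) y.
  rewrite -subr_eq0 -dotpBr dotp_plane_generator subr_eq0; exact: wij.
by rewrite neq_lt => /orP[]; apply: split.
Qed.

Lemma compact_minimizer (R : realType) N (K : set 'cV[R]_N) (w : 'cV[R]_N) :
  compact K -> K !=set0 -> exists x, is_minimizer K (dotp w) x.
Proof.
move=> cK K0; have [|x /set_mem Kx xm] := compact_EVT_min (f := dotp w) K0 cK.
  apply: continuous_subspaceT => x.
  by apply: (@cvg_dotp _ _ _ (nbhs x)); [exact: cvg_cst|exact: cvg_id].
by exists x; split => // y Ky; apply: xm; exact/mem_set.
Qed.

(** The exceptional event is covered by the event that [w] is off the sphere and countably many null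
    events, one for each plane and pair of rationals. *)
Lemma ae_unique_minimizer (R : realType) (N : nat) (K : set 'cV[R]_N)
    (disp : measure_display) (Omega : measurableType disp)
    (P : probability Omega R) (w : {RV P >-> borel_cV R N}) :
  compact K -> K !=set0 -> uniform_on_sphere (distribution P w) ->
  {ae P, forall omega, exists x,
    unique (is_minimizer K (dotp (w omega))) x}.
Proof.
move=> cK K0 unifw.
have mpre (B : set (borel_cV R N)) : measurable B -> measurable (w @^-1` B).
  by move=> mB; rewrite -[X in measurable X]setTI; exact: measurable_funPT.
have msphere : measurable (@unit_sphere R N).
  apply: closed_measurable_borel.
  apply: (@preimage_closed _ _ (fun x : 'cV[R]_N => dotp x x) [set r | r = 1]).
    by move=> x _; apply: (@cvg_dotp _ _ _ (nbhs x)); exact: cvg_id.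
  exact: closed_eq.
have null0 : P.-negligible (w @^-1` (~` @unit_sphere R N)).
  apply/negligibleP; first by apply: mpre; exact: measurableC.
  have := probability_setC (distribution P w) msphere.
  by rewrite unifw.1 subee.
pose B (t : 'I_N * 'I_N * rat * rat) : set (borel_cV R N) :=
  let: (i, j, p, q) := t in
  if (i != j) && (p < q)
  then split_minimizers K (plane_generator R i j) (ratr p) (ratr q) else set0.
have nullB t : P.-negligible (w @^-1` B t).
  case: t => [[[i j] p] q] /=; case: ifPn => [/andP[ij pq]|_]; last first.
    by rewrite preimage_set0; exact: negligible_set0.
  apply/negligibleP.
    apply: mpre; apply: closed_measurable_borel.
    exact: split_minimizers_closed.
  apply: (split_minimizers_null cK unifw).
  - exact: plane_generatorT.
  - exact: plane_generator_cube.
  - by rewrite ltr_rat.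
(* The index tuples are coded by natural numbers, with the empty event at the numbers that code no
   tuple. *)
pose F k := if unpickle k is Some t then w @^-1` B t else set0.
apply: (negligibleS _ (negligibleU null0 (negligible_bigcup (F := F) _)));
  last first.
  move=> k; rewrite /F; case: unpickle => [t|]; first exact: nullB.
  exact: negligible_set0.
move=> omega /= nuniq; apply: contrapT => /not_orP[/contrapT w1 nB].
apply: nuniq; have [x xm] := compact_minimizer (w omega) cK K0.
exists x; split => // y ym; apply: unique_off_split_minimizers w1 _ xm ym.
move=> i j p q ij pq wB; apply: nB; exists (pickle (i, j, p, q)); first by [].
by rewrite /F pickleK /= ij pq.
Qed.

(** * The optimal set of the convexified problem *)

Lemma cV_compact_box (R : realType) N (M : R) :
  compact [set x : 'cV[R]_N | forall k, `|x k 0| <= M].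
Proof.
pose B := [set v : 'rV[R]_N | forall k, `[- M, M]%classic (v 0 k)].
have cB : compact B.
  apply: (@rV_compact R _ (fun=> `[- M, M]%classic)) => k.
  exact: segment_compact.
have -> : [set x : 'cV[R]_N | forall k, `|x k 0| <= M] = trmx @` B.
  apply/seteqP; split=> x /=.
    move=> xM; exists x^T; last by rewrite trmxK.
    by move=> k; rewrite /= mxE in_itv /= -ler_norml.
  move=> [v vB <-] k; rewrite mxE ler_norml.
  by have := vB k; rewrite /= in_itv.
apply: continuous_compact cB; apply: continuous_subspaceT => v.
apply: (@cvg_colP _ _ _ (nbhs v)) => k; rewrite mxE.
have -> : (fun t : 'rV[R]_N => t^T k 0) = (fun t => t 0 k).
  by apply: funext => t; rewrite mxE.
exact: cvg_mx_coord.
Qed.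

(** Reduces lower semicontinuity of a sum of extended reals to that of its terms. If all terms are
    finite, the gap is shared out; otherwise one infinite term makes up for all the others. *)
Lemma lt_esum_split (R : realType) (I : finType) (g : I -> \bar R) (r : R) :
  (forall i, g i != -oo%E) -> (r%:E < \sum_i g i)%E ->
  exists b : I -> R, (forall i, ((b i)%:E < g i)%E) /\ r < \sum_i b i.
Proof.
move=> gNy rg.
have [gfin|] := pselect (forall i, g i \is a fin_num).
  pose e := (\sum_i fine (g i) - r) / #|I|.+1%:R.
  have rg' : r < \sum_i fine (g i).
    rewrite -lte_fin -sumEFin; apply: lt_le_trans rg _; apply: lee_sum => i _.
    by rewrite fineK.
  have e0 : 0 < e by rewrite divr_gt0 ?subr_gt0.
  exists (fun i => fine (g i) - e); split.
    by move=> i; rewrite -[ltRHS]fineK // lte_fin ltrBlDr ltrDl.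
  rewrite sumrB sumr_const ltrBrDl -ltrBrDr -mulr_natr /e mulrAC ltr_pdivrMr //.
  by rewrite ltr_pM2l ?subr_gt0 // ltr_nat.
move=> /existsNP[i0 gi0].
have {}gi0 : g i0 = +oo%E.
  by move: gi0 (gNy i0); case: (g i0).
pose c i := if g i is s%:E then s - 1 else 0.
have cg i : ((c i)%:E < g i)%E.
  rewrite /c; move: (gNy i); case: (g i) => //= [s _|_]; last exact: ltry.
  by rewrite lte_fin; lra.
pose b i := if i == i0 then r + 1 - \sum_(j | j != i0) c j else c i.
exists b; split.
  by move=> i; rewrite /b; case: eqP => [->|//]; rewrite gi0 ltry.
have bc : \sum_(j | j != i0) b j = \sum_(j | j != i0) c j.
  by apply: eq_bigr => j /negbTE; rewrite /b => ->.
by rewrite (bigD1 i0) //= bc /b eqxx subrK ltrDl.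
Qed.

Lemma esum_fin_num (R : realType) (I : finType) (g : I -> \bar R) :
  (forall i, g i != -oo%E) -> (\sum_i g i < +oo)%E ->
  forall i, g i \is a fin_num.
Proof.
move=> gNy glt i; rewrite fin_numE gNy /=; apply/eqP => giy.
have : (\sum_i g i)%E = +oo%E.
  by apply/esum_eqyP => //; exists i; split => //; rewrite mem_index_enum.
by move=> e; rewrite e ltxx in glt.
Qed.

(** One step size for finitely many bounds: the sum [T] dominates each ratio, which avoids a minimum
    over [I]. *)
Lemma small_scale (R : realFieldType) (I : finType) (a c : I -> R) :
  (forall i, 0 < c i) ->
  exists2 s, 0 < s & forall t i, `|t| <= s -> `|t * a i| <= c i.
Proof.
move=> c0; pose T := 1 + \sum_i `|a i| / c i.
have T0 : 0 < T.
  by rewrite ltr_pwDl // sumr_ge0 // => i _; rewrite divr_ge0 // ltW.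
exists T^-1; first by rewrite invr_gt0.
move=> t i tT; rewrite normrM (le_trans (ler_wpM2r _ tT)) //.
rewrite mulrC ler_pdivrMr // mulrC -ler_pdivrMr // /T (bigD1 i) //= addrCA.
by rewrite lerDl addr_ge0 // sumr_ge0 // => j _; rewrite divr_ge0 // ltW.
Qed.

Section FeasibleSet.
Context {R : realType} {n : nat} {d : 'I_n -> nat}.
Local Notation N := (\sum_i d i)%N.
Context {m1 m2 : nat}.
Variables (A : 'M[R]_(m1, N)) (b : 'cV[R]_m1).
Variables (G : 'M[R]_(m2, N)) (h : 'cV[R]_m2).
Variables (S : forall i : 'I_n, set 'cV[R]_(d i)).
Variable f : forall i : 'I_n, 'cV[R]_(d i) -> R.
Arguments S : clear implicits.
Arguments f : clear implicits.
Hypotheses (cS : forall i, compact (S i))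
  (lscf : forall i,
    lower_semicontinuous (EFin \o f i : subspace (S i) -> \bar R)).

Let env i := ext_envelope (S i) (f i).
Arguments env : clear implicits.
Let f_hat := separable_sum env.

Lemma env_neqNy i x : env i x != -oo%E.
Proof.
have [c cE] := ext_envelope_bounded_below (@cS i) (@lscf i).
by rewrite -ltNye; apply: lt_le_trans (cE x); exact: ltNyr.
Qed.

(** A strict lower bound on the envelope puts [(x, a)] outside the closed set [comb_epi], and this
    is an open condition. *)
Lemma near_env_gt T (F : set_system T) {FF : Filter F} i
    (g : T -> 'cV[R]_(d i)) (x : 'cV[R]_(d i)) a :
  g @ F --> x -> (a%:E < env i x)%E ->
  \forall t \near F, (a%:E < env i (g t))%E.
Proof.
move=> gx; rewrite ltNge => /negP xa.
have nxa : ~ comb_epi (S i) (f i) (x, a : R^o).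
  by move=> /(ext_envelope_leP (@cS i) (@lscf i)).
have := comb_epi_closed (@cS i) (@lscf i).
rewrite -openC openE => /(_ _ nxa) nbhs_xa.
have gax : (fun t => (g t, a : R^o)) @ F --> (x, a : R^o).
  exact: (@cvg_pair _ _ _ F (nbhs x) (nbhs (a : R^o)) _ (nbhs_filter x)
    (nbhs_filter (a : R^o)) _ _ gx (cvg_cst _)).
have nF : F (fun t => ~ comb_epi (S i) (f i) (g t, a : R^o)).
  exact: gax nbhs_xa.
apply: filterS nF => t nta; rewrite ltNge; apply/negP.
by move=> /(ext_envelope_leP (@cS i) (@lscf i)).
Qed.

Lemma cvg_submxcol T (F : set_system T) {FF : Filter F} (g : T -> 'cV[R]_N)
    (x : 'cV[R]_N) i :
  g @ F --> x -> (fun t => submxcol (g t) i) @ F --> submxcol x i.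
Proof.
move=> gx; apply: cvg_colP => k; rewrite mxE.
have -> : (fun t => submxcol (g t) i k 0) = (fun t => g t (tagnat.Rank i k) 0).
  by apply: funext => t; rewrite mxE.
exact: cvg_col_coord.
Qed.

Lemma near_f_hat_gt T (F : set_system T) {FF : Filter F} (g : T -> 'cV[R]_N)
    (x : 'cV[R]_N) r : g @ F --> x -> (r%:E < f_hat x)%E ->
  \forall t \near F, (r%:E < f_hat (g t))%E.
Proof.
move=> gx /lt_esum_split[i|c [cE rc]]; first exact: env_neqNy.
have : \forall t \near F, forall i, ((c i)%:E < env i (submxcol (g t) i))%E.
  by apply: filter_forall => i; apply: near_env_gt (cE i); exact: cvg_submxcol.
apply: filterS => t ct; apply: (@lt_le_trans _ _ (\sum_i (c i)%:E)%E).
  by rewrite sumEFin lte_fin.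
by apply: lee_sum => i _; exact: ltW.
Qed.

(** A finite sum makes every block envelope finite, so each block is a convex combination of points
    of the bounded set [S i]. *)
Lemma f_hat_sublevel_bounded : exists M, forall x r, (f_hat x <= r%:E)%E ->
  forall k, `|x k 0| <= M.
Proof.
have HM i := comb_epi_bounded (f i) (@cS i).
pose M i := sval (cid (HM i)).
exists (\sum_i `|M i|) => x r xr k.
have fin := esum_fin_num (fun i => env_neqNy (submxcol x i))
    (le_lt_trans xr (ltry r)).
rewrite -[x]submxcolK mxE; set i := tagnat.sig1 k.
have Mi : `|submxcol x i (tagnat.sig2 k) 0| <= M i.
  apply: (svalP (cid (HM i)) _ (fine (env i (submxcol x i)))).
  by apply/(ext_envelope_leP (@cS i) (@lscf i)); rewrite fineK.
apply: le_trans Mi _; apply: le_trans (ler_norm _) _.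
by rewrite (bigD1 i) //= lerDl sumr_ge0.
Qed.

Lemma lin_feasible_closed : closed (lin_feasible A b G h).
Proof.
have -> : lin_feasible A b G h =
  (\bigcap_j ((fun x => (A *m x) j 0) @^-1` [set s | s <= b j 0])) `&`
  (\bigcap_k ((fun x => (G *m x) k 0) @^-1` [set s | s = h k 0])).
  apply/seteqP; split=> x /=.
    by move=> [Ax Gx]; split => [j _|k _] /=; rewrite ?Gx.
  move=> [Ax Gx]; split=> [j|]; first exact: Ax.
  by apply/colP => k; exact: Gx.
have cont m (M : 'M[R]_(m, N)) j :
    continuous (fun x : 'cV[R]_N => (M *m x) j 0).
  move=> x; apply: (@cvg_col_coord _ _ _ (nbhs x) _ (fun x => M *m x)).
  exact: continuous_mulmx.
apply: closedI; apply: closed_bigI => j _; apply: preimage_closed.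
- by move=> x _; exact: cont.
- exact: closed_le.
- by move=> x _; exact: cont.
- exact: closed_eq.
Qed.

Lemma sublevel_compact r :
  compact (lin_feasible A b G h `&` [set x | (f_hat x <= r%:E)%E]).
Proof.
have [M HM] := f_hat_sublevel_bounded.
apply: subclosed_compact (cV_compact_box (M := M)) _; last first.
  by move=> x [_ /= xr] k; exact: HM xr k.
apply: closedI; first exact: lin_feasible_closed.
rewrite -openC openE => x /= /negP; rewrite -ltNge => rx.
have : nbhs x (fun y => (r%:E < f_hat y)%E).
  by apply: (@near_f_hat_gt _ (nbhs x) _ id) rx; exact: cvg_id.
by apply: filterS => y; rewrite ltNge => /negP.
Qed.

(** Otherwise [f_hat] exceeds [r] at every feasible point and, by compactness of a sublevel set,
    exceeds it there by a uniform [e > 0], so [r] is not the infimum. *)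
Lemma p_hat_attained r : optimal_value A b G h f_hat = r%:E ->
  exists2 x, lin_feasible A b G h x & (f_hat x <= r%:E)%E.
Proof.
move=> pr; apply: contrapT => nex.
have gt x : lin_feasible A b G h x -> (r%:E < f_hat x)%E.
  by move=> lx; rewrite ltNge; apply/negP => xr; apply: nex; exists x.
pose K := lin_feasible A b G h `&` [set x | (f_hat x <= (r + 1)%:E)%E].
have NC := (compact_near_coveringP K).1 (@sublevel_compact (r + 1)).
have : \forall e \near 0^'+, K `<=` (fun x => (r + e)%:E < f_hat x)%E.
  apply: (NC _ _ (fun e x => (r + e)%:E < f_hat x)%E) => x [lx _].
  have [s [rs sx]] : exists s, r < s /\ (s%:E < f_hat x)%E.
    have := gt _ lx; case: (f_hat x) => [y|_|//]; last first.
      by exists (r + 1); rewrite ltrDl ltry.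
    by rewrite lte_fin => ry; exists ((r + y) / 2); rewrite lte_fin; split; lra.
  near=> y e => /=; apply: (@lt_trans _ _ s%:E).
    rewrite lte_fin -ltrBrDl; near: e; apply: nbhs_right_lt; lra.
  near: y; apply: (@near_f_hat_gt _ (nbhs x) _ id) sx; exact: cvg_id.
move=> /(filterI (nbhs_right_gt 0))/(filterI (nbhs_right_lt ltr01)).
move=> /filter_ex[e [/= e1 [e0 KP]]].
have : (optimal_value A b G h f_hat < (r + e)%:E)%E by rewrite pr lte_fin ltrDl.
move=> /ereal_inf_lt[_ [x lx <-] xre].
have /KP : K x.
  split => //=; apply: le_trans (ltW xre) _; rewrite lee_fin; lra.
by rewrite ltNge ltW.
Unshelve. all: end_near. Qed.

End FeasibleSet.

(** * Blocks where the envelope is not attained *)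

Section ExtremeBlocks.
Context {R : realType} {n : nat} {d : 'I_n -> nat}.
Local Notation N := (\sum_i d i)%N.
Context {m1 m2 : nat}.
Variables (A : 'M[R]_(m1, N)) (b : 'cV[R]_m1).
Variables (G : 'M[R]_(m2, N)) (h : 'cV[R]_m2).
Variables (S : forall i : 'I_n, set 'cV[R]_(d i)).
Variable f : forall i : 'I_n, 'cV[R]_(d i) -> R.
Arguments S : clear implicits.
Arguments f : clear implicits.
Hypotheses (cS : forall i, compact (S i))
  (lscf : forall i,
    lower_semicontinuous (EFin \o f i : subspace (S i) -> \bar R)).

Let env i := ext_envelope (S i) (f i).
Arguments env : clear implicits.
Let f_hat := separable_sum env.
Let K r := lin_feasible A b G h `&` [set x | (f_hat x <= r%:E)%E].

Lemma submxcolD (x y : 'cV[R]_N) i :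
  submxcol (x + y) i = submxcol x i + submxcol y i.
Proof. by apply/colP => k; rewrite !mxE. Qed.

Lemma submxcolZ a (x : 'cV[R]_N) i :
  submxcol (a *: x) i = a *: submxcol x i.
Proof. by apply/colP => k; rewrite !mxE. Qed.

Lemma submxcol_sumZ (I : finType) (a : I -> R) (D : I -> 'cV[R]_N) i :
  submxcol (\sum_j a j *: D j) i = \sum_j a j *: submxcol (D j) i.
Proof.
apply/colP => k; rewrite mxE !summxE; apply: eq_bigr => j _.
by rewrite !mxE.
Qed.

Lemma unique_minimizer_nonextreme_blocks (r : R) (w x : 'cV[R]_N) :
  optimal_value A b G h f_hat = r%:E ->
  unique (is_minimizer (K r) (dotp w)) x ->
  (#|[set i | env i (submxcol x i) != ext_fun (S i) (f i) (submxcol x i)]%SET|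
    <= max_active A b + m2)%N.
Proof.
move=> pr [[Kx xmin] xuniq]; have [[Ax Gx] /= xr] := Kx.
set T := [set i | _]%SET; rewrite leqNgt; apply/negP => ltT.
have fin := esum_fin_num (fun i => env_neqNy (@cS) (@lscf) (submxcol x i))
  (le_lt_trans xr (ltry r)).
have fx : f_hat x = r%:E.
  apply/eqP; rewrite eq_le xr /= -pr; apply: ereal_inf_lbound.
  by exists x => //; have [] := Kx.
(* Blocks outside [T] get the zero direction with radius 1, so that a choice exists for every
   block. *)
have dir i : exists z : 'cV[R]_(d i) * R * R,
    [/\ i \in T -> z.1.1 != 0, 0 < z.2 & forall t, `|t| <= z.2 ->
      (env i (submxcol x i + t *: z.1.1)%R <=
       env i (submxcol x i) + (t * z.1.2)%:E)%E].
  have [iT|iT] := boolP (i \in T); last first.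
    exists (0, 0, 1); split => //= t _.
    by rewrite scaler0 addr0 mulr0 adde0.
  have [||v [g [e [v0 e0 vge]]]] :=
      @ext_envelope_affine_direction _ _ _ _ (@cS i) (@lscf i) (submxcol x i).
  - by have := fin i; rewrite fin_numElt => /andP[].
  - by move: iT; rewrite inE.
  - by exists (v, g, e); split.
pose z i := sval (cid (dir i)); pose v i := (z i).1.1.
pose g i := (z i).1.2; pose e i := (z i).2.
have vT i : i \in T -> v i != 0 by have [] := svalP (cid (dir i)).
have e0 i : 0 < e i by have [] := svalP (cid (dir i)).
have env_le i t : `|t| <= e i -> (env i (submxcol x i + t *: v i)%R <=
    env i (submxcol x i) + (t * g i)%:E)%E.
  by have [_ _] := svalP (cid (dir i)); exact.
pose J := active A b x.
(* [D i] moves block [i] alone, and [u i] is its effect on the active inequalities and the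
   equalities; a dependence among the [u i] is a move that preserves all of these. *)
pose D i : 'cV[R]_N := \mxcol_k ((k == i)%:R *: v k).
pose u i : 'cV[R]_(#|J| + m2) :=
  col_mx (rowsub (fun k : 'I_#|J| => enum_val k) (A *m D i)) (G *m D i).
have JT : (#|J| + m2 < #|T|)%N.
  apply: leq_ltn_trans ltT; rewrite leq_add2r.
  apply: (bigop.leq_bigmax_cond
    (P := fun J' => `[< exists y, active A b y = J' >])).
  by apply/asboolP; exists x.
have [a [[i0 ai0] aT au]] := linear_dependence u JT.
pose y := \sum_i a i *: D i.
have yi i : submxcol y i = a i *: v i.
  rewrite submxcol_sumZ; under eq_bigr do rewrite mxcolK.
  rewrite (bigD1 i) //= eqxx scale1r big1 ?addr0 // => j ji.
  by rewrite eq_sym (negbTE ji) scale0r scaler0.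
have AJy j : j \in J -> (A *m y) j 0 = 0.
  move=> jJ; pose k := enum_rank_in jJ j.
  transitivity (usubmx (\sum_i a i *: u i) k 0); last by rewrite au !mxE.
  rewrite /y mulmx_sumr linear_sum /= !summxE; apply: eq_bigr => i _.
  rewrite -scalemxAr linearZ /= /u col_mxKu [LHS]mxE [RHS]mxE; congr (_ * _).
  by rewrite [RHS]mxE enum_rankK_in.
have Gy : G *m y = 0.
  transitivity (dsubmx (\sum_i a i *: u i)); last by rewrite au linear0.
  rewrite /y mulmx_sumr linear_sum /=; apply: eq_bigr => i _.
  by rewrite -scalemxAr linearZ /= /u col_mxKd.
have y0 : y != 0.
  apply/eqP => y0; have /eqP := yi i0; rewrite y0.
  have -> : submxcol (0 : 'cV[R]_N) i0 = 0 by apply/colP => k; rewrite !mxE.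
  rewrite eq_sym scaler_eq0 (negbTE ai0) /=; apply/negP/vT.
  by apply: contraT => /aT /eqP; rewrite (negbTE ai0).
have [s1 s10 s1P] := small_scale a e0.
(* Active rows do not change along [y], so any positive number serves as their slack. *)
pose slack j := if j \in J then 1 else b j 0 - (A *m x) j 0.
have slack0 j : 0 < slack j.
  rewrite /slack; case: ifPn => // jJ; rewrite subr_gt0 lt_neqAle Ax andbT.
  by apply: contra jJ => /eqP Axb; rewrite inE !mxE subr_eq0 -Axb mxE.
have [s2 s20 s2P] := small_scale (fun j => (A *m y) j 0) slack0.
pose s := Num.min s1 s2.
have s0 : 0 < s by rewrite lt_min s10.
have lin t : `|t| <= s -> lin_feasible A b G h (x + t *: y).
  rewrite le_min => /andP[_ ts]; split => [j|]; last first.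
    by rewrite mulmxDr -scalemxAr Gy scaler0 addr0.
  rewrite mulmxDr -scalemxAr mxE [X in _ + X]mxE.
  have [jJ|jJ] := boolP (j \in J); first by rewrite AJy // mulr0 addr0.
  have := s2P t j ts; rewrite /slack (negbTE jJ) => tj.
  by rewrite -lerBrDl (le_trans (ler_norm _)).
pose gam := \sum_i a i * g i.
have f_hat_le t : `|t| <= s -> (f_hat (x + t *: y) <= (r + t * gam)%:E)%E.
  rewrite le_min => /andP[ts _].
  rewrite EFinD -fx mulr_sumr -sumEFin -big_split.
  apply: lee_sum => i _; rewrite submxcolD submxcolZ yi scalerA mulrA.
  by apply: env_le; exact: s1P.
(* [r] is the optimal value and both signs of [t] are allowed, so the slope of the affine upper
   bound vanishes. *)
have gam0 : gam = 0.
  have tgam t : `|t| <= s -> 0 <= t * gam.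
    move=> ts; rewrite -(lerD2l r) addr0 -lee_fin -{1}pr.
    apply: le_trans (f_hat_le _ ts); apply: ereal_inf_lbound.
    by exists (x + t *: y) => //; exact: lin.
  have := tgam s; have := tgam (- s); rewrite normrN gtr0_norm // lexx.
  rewrite mulNr oppr_ge0 => /(_ isT) le0 /(_ isT) ge0; apply/eqP.
  by rewrite -(mulrI_eq0 _ (lregP (lt0r_neq0 s0))) eq_le le0.
have Kt t : `|t| <= s -> K r (x + t *: y).
  move=> ts; split; first exact: lin.
  by have := f_hat_le _ ts; rewrite gam0 mulr0 addr0.
(* The same two-sided argument makes [dotp w] constant along [y], so [x + s *: y] is a second
   minimizer. *)
have wy : dotp w y = 0.
  have twy t : `|t| <= s -> 0 <= t * dotp w y.
    by move=> /Kt/xmin; rewrite dotpDr dotpZr lerDl.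
  have := twy s; have := twy (- s); rewrite normrN gtr0_norm // lexx.
  rewrite mulNr oppr_ge0 => /(_ isT) le0 /(_ isT) ge0; apply/eqP.
  by rewrite -(mulrI_eq0 _ (lregP (lt0r_neq0 s0))) eq_le le0.
have /xuniq/eqP : is_minimizer (K r) (dotp w) (x + s *: y).
  split; first by apply: Kt; rewrite gtr0_norm.
  by move=> x' Kx'; rewrite dotpDr dotpZr wy mulr0 addr0 xmin.
by rewrite -subr_eq0 opprD addNKr oppr_eq0 scaler_eq0 (negbTE y0) gt_eqF.
Qed.


End ExtremeBlocks.

(** * Comparison with the largest nonconvexities *)

Lemma leq_nth_sorted (s : seq nat) k :
  sorted ltn s -> (k < size s)%N -> (k <= nth 0 s k)%N.
Proof.
move=> ss; elim: k => // k IH ks; apply: leq_ltn_trans (IH (ltnW ks)) _.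
by apply: (sorted_ltn_nth ltn_trans 0 ss); rewrite ?inE // ltnW.
Qed.

Lemma leq_enum_val n (T : {set 'I_n}) (k : 'I_#|T|) : (k <= enum_val k)%N.
Proof.
have kT : (k < size (map val (enum T)))%N by rewrite size_map -cardE.
have -> : nat_of_ord (enum_val k) = nth 0%N (map val (enum T)) k.
  by rewrite (nth_map (enum_val k)) -?cardE // -enum_val_nth.
apply: leq_nth_sorted => //; rewrite sorted_map /enum_mem.
apply: sorted_filter; first by move=> i j l; exact: ltn_trans.
by rewrite -enumT -sorted_map val_enum_ord iota_ltn_sorted.
Qed.

(** Counting from 0, the [k]-th smallest index in [T] is at least [k], so its term is at most the
    one at index [k]; nonnegativity then allows more terms. *)
Lemma lee_sum_largest (R : realType) n m (rho : 'I_n -> \bar R)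
    (T : {set 'I_n}) : (forall i, (0 <= rho i)%E) ->
  (forall i j : 'I_n, (i <= j)%N -> (rho j <= rho i)%E) -> (#|T| <= m)%N ->
  (\sum_(i in T) rho i <= \sum_(i < n | (i < minn m n)%N) rho i)%E.
Proof.
move=> rho0 rho_anti Tm.
have Tn : (#|T| <= n)%N by rewrite -[leqRHS]card_ord max_card.
rewrite big_enum_val /=.
apply: (@le_trans _ _ (\sum_(i < n | (i < #|T|)%N) rho i)%E).
  rewrite (big_ord_narrow Tn) /=; apply: lee_sum => k _.
  by apply: rho_anti => /=; exact: leq_enum_val.
rewrite big_mkcond [leRHS]big_mkcond /=; apply: lee_sum => i _.
case: ifPn => iT; last by case: ifP.
by rewrite ifT // leq_min ltn_ord (leq_trans iT).
Qed.

(** A finite envelope rules out the [+oo - +oo] branch of [esub0] and can be moved across the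
    inequality. *)
Lemma ext_fun_le_nonconvexity (R : realType) d (S : set 'cV[R]_d)
    (f : 'cV[R]_d -> R) x : ext_envelope S f x \is a fin_num ->
  (ext_fun S f x <= ext_envelope S f x + nonconvexity S f)%E.
Proof.
move=> fin; rewrite addeC -leeBlDr //; apply: ereal_sup_ubound.
exists x => //; rewrite /esub0; case: eqP => //= _.
by case: eqP fin => // ->.
Qed.

Lemma nonconvexity_ge0 (R : realType) d (S : set 'cV[R]_d)
    (f : 'cV[R]_d -> R) : compact S ->
  lower_semicontinuous (EFin \o f : subspace S -> \bar R) ->
  (0 <= nonconvexity S f)%E.
Proof.
move=> cS lscf.
(* Any point would do in place of 0: where both functions are infinite, [esub0] gives 0. *)
apply: (@le_trans _ _ (esub0 (ext_fun S f 0) (ext_envelope S f 0))).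
  have [c /(_ 0)] := ext_envelope_bounded_below cS lscf.
  have := ext_envelope_le cS lscf 0; rewrite /esub0.
  case: (ext_fun S f 0) (ext_envelope S f 0) => [u| |] [v| |] //=.
    by move=> vu _; rewrite -EFinB lee_fin subr_ge0 -lee_fin.
  by rewrite addye // leey.
by apply: ereal_sup_ubound; exists 0.
Qed.

Theorem theorem2 (R : realType) (n m1 m2 : nat) (d : 'I_n -> nat)
    (S : forall i : 'I_n, set 'cV[R]_(d i))
    (f : forall i : 'I_n, 'cV[R]_(d i) -> R)
    (A : 'M[R]_(m1, (\sum_i d i)%N)) (b : 'cV[R]_m1)
    (G : 'M[R]_(m2, (\sum_i d i)%N)) (h : 'cV[R]_m2)
    (disp : measure_display) (Omega : measurableType disp)
    (P : probability Omega R)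
    (w : {RV P >-> borel_cV R (\sum_i d i)%N}) :
  let f_ext := separable_sum (fun i => ext_fun (S i) (f i)) in
  let f_hat := separable_sum (fun i => ext_envelope (S i) (f i)) in
  let rho := fun i => nonconvexity (S i) (f i) in
  let p_star := optimal_value A b G h f_ext in
  let p_hat := optimal_value A b G h f_hat in
  let m_tilde := (max_active A b + m2)%N in
  let eps := (\sum_(i < n | (i < minn m_tilde n)%N) rho i)%E in
  let feasible_R := lin_feasible A b G h `&` [set x | (f_hat x <= p_hat)%E] in
  (forall i, compact (S i)) ->
  (forall i, lower_semicontinuous (EFin \o f i : subspace (S i) -> \bar R)) ->
  involves_two_blocks A ->
  involves_two_blocks G ->
  (forall i j : 'I_n, (i <= j)%N -> (rho j <= rho i)%E) ->
  (exists x, lin_feasible A b G h x /\ forall i, S i (submxcol x i)) ->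
  uniform_on_sphere (distribution P w) ->
  {ae P, forall omega, exists x_star,
    unique (is_minimizer feasible_R (dotp (w omega))) x_star /\
    (f_ext x_star <= p_hat + eps)%E /\
    (f_ext x_star <= p_star + eps)%E}.
Proof.
move=> f_ext f_hat rho p_star p_hat m_tilde eps feasible_R cS lscf _ _ rho_anti.
move=> [x0 [lx0 Sx0]] unifw.
have hat_ext x : (f_hat x <= f_ext x)%E.
  by apply: lee_sum => i _; exact: ext_envelope_le.
have p_hat_star : (p_hat <= p_star)%E.
  apply/ereal_infP => _ [x lx <-]; apply: le_trans (hat_ext x).
  by apply: ereal_inf_lbound; exists x.
have [r pr] : exists r, p_hat = r%:E.
  have lt : (p_hat < +oo)%E.
    apply: (@le_lt_trans _ _ (f_ext x0)).
      by apply: le_trans (hat_ext x0); apply: ereal_inf_lbound; exists x0.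
    rewrite /f_ext /separable_sum.
    under eq_bigr do rewrite /ext_fun /pinfty_outside ifT ?inE //=.
    by rewrite sumEFin ltry.
  have gt : (-oo < p_hat)%E.
    have cE i := ext_envelope_bounded_below (@cS i) (@lscf i).
    apply: (@lt_le_trans _ _ (\sum_i (sval (cid (cE i)))%:E)%E).
      by rewrite sumEFin ltNyr.
    apply/ereal_infP => _ [x _ <-]; apply: lee_sum => i _.
    exact: (svalP (cid (cE i))).
  by exists (fine p_hat); rewrite fineK // fin_numElt gt.
have feasE : feasible_R =
    lin_feasible A b G h `&` [set x | (f_hat x <= r%:E)%E].
  by rewrite /feasible_R pr.
have cR : compact feasible_R by rewrite feasE; exact: sublevel_compact.
have [x1 lx1 x1r] := p_hat_attained cS lscf pr.
have R0 : feasible_R !=set0 by rewrite feasE; exists x1.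
apply: filterS (ae_unique_minimizer cR R0 unifw) => omega [x xuniq].
exists x; split => //.
suff le_hat : (f_ext x <= p_hat + eps)%E.
  by split => //; apply: le_trans le_hat _; exact: leeD2r.
have [[[lx /= xr] _] _] := xuniq.
have xuniq' := xuniq; rewrite feasE in xuniq'.
have cardT := unique_minimizer_nonextreme_blocks cS lscf pr xuniq'.
set T := [set i | _]%SET in cardT.
have fin := esum_fin_num (fun i => env_neqNy cS lscf (submxcol x i))
  (le_lt_trans xr _).
(* Blocks outside [T] contribute exactly their envelope, blocks in [T] at most [rho i] more. *)
apply: (@le_trans _ _ (\sum_i (ext_envelope (S i) (f i) (submxcol x i) +
    if i \in T then rho i else 0))%E).
  apply: lee_sum => i _; rewrite inE; case: eqP => [<-|_] /=.
    by rewrite adde0.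
  by apply: ext_fun_le_nonconvexity; apply: fin; rewrite pr ltry.
rewrite big_split /= -big_mkcond /=; apply: leeD => //.
by apply: lee_sum_largest => // i; exact: nonconvexity_ge0.
Qed.
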